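(* Fix $C>0$, and let $X_1,\ldots,X_n$ be complex-valued random variables (not necessarily independent nor identically distributed) which satisfy the following axioms. (i) (Upper bound) With overwhelming probability, $\max_{1\le i\le n}|X_i|\le e^{n^C}$. (ii) (Anti-concentration) For every $a>0$, there exists $b>0$ such that $$\left|\sum_{i=1}^n\frac{1}{Z-X_i}\right|\ge n^{-b}$$ with probability $1-O_a(n^{-a})$, where $Z$ is uniformly distributed on $B(0,n^C)$, independent of $X_1,\ldots,X_n$. Let $\varphi:\mathbb{C}\to\mathbb{R}$ be a twice continuously differentiable function (possibly depending on $n$) which is supported on $B(0,n^C)$ and which satisfies the pointwise bound $|\Delta\varphi(z)|\le n^C$ for all $z\in\mathbb{C}$. Then, for every fixed $c>0$ and every $\alpha>0$, $$\sum_{j=1}^{n-1}\varphi(w_j^{(n)})=\sum_{i=1}^n\varphi(X_i)+O_\alpha(\|\Delta\varphi\|_1\log n)+O_\alpha(n^{-c})$$ with probability $1-O_\alpha(n^{-\alpha})$, where $w_1^{(n)},\ldots,w_{n-1}^{(n)}$ are the critical points of the polynomial $p_n(z):=\prod_{i=1}^n(z-X_i)$ and $\|\Delta\varphi\|_1$ is the $L_1$-norm of $\Delta\varphi$. Here, the implicit constants in the asymptotic notation depend on $C$, $c$, and $\alpha$.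
   Context: $B(z_0,r)=\{z\in\mathbb{C}:|z-z_0|<r\}$ and $\Delta$ is the Laplacian on $\mathbb{C}\cong\mathbb{R}^2$. The $L_1$-norm is with respect to Lebesgue measure on $\mathbb{C}$, and critical points are listed with multiplicity. An event $E$ (depending on $n$) holds with overwhelming probability if for every $\alpha>0$, $\mathbb{P}(E)\ge1-O_\alpha(n^{-\alpha})$. Asymptotic notation is as $n\to\infty$: $X_n=O(Y_n)$ means $|X_n|\le KY_n$ for some constant $K>0$ and all $n>K$; subscripts indicate parameters on which the constant depends. *)

(* Defs.v *)
From HB Require Import structures.
From mathcomp Require Import all_boot all_order all_algebra.
From mathcomp Require Import complex.
From mathcomp Require Import all_classical all_reals all_analysis.
From mathcomp Require Import measurable_realfun.

Set Implicit Arguments.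
Unset Strict Implicit.
Unset Printing Implicit Defensive.

Import Order.TTheory GRing.Theory Num.Theory.
Import numFieldNormedType.Exports.

Local Open Scope classical_set_scope.
Local Open Scope ring_scope.

(* [R * R] with its Borel sigma-algebra. [R[i]] is neither a [measurableType]
   nor a [normedModType R], so measure theory and real differentiation on C
   take place here. *)
Notation plane R := (measurableTypeR R * measurableTypeR R)%type.

Definition toC (R : realType) (z : R * R) : R[i] := (z.1 +i* z.2)%C.

(* [`|z|] has type [R[i]]; this is the same number as an element of [R]. *)
Definition modulus (R : realType) (z : R[i]) : R := Normc.normc z.

Definition lebesgue2 (R : realType) : {measure set (plane R) -> \bar R} :=
  (@lebesgue_measure R \x @lebesgue_measure R)%E.

Definition disk (R : realType) (r : R) : set (plane R) :=
  [set z | modulus (toC z) < r].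

Lemma measurable_disk (R : realType) (r : R) : measurable (disk r).
Proof.
have mf : measurable_fun [set: plane R]
    (fun z : plane R => Num.sqrt (z.1 ^+ 2 + z.2 ^+ 2) : R).
  apply: measurableT_comp;
    first exact: continuous_measurable_fun (@sqrt_continuous R).
  by apply: measurable_funD; apply: measurable_funX;
    [exact: measurable_fst|exact: measurable_snd].
rewrite (_ : disk r = [set: plane R] `&`
    (fun z : plane R => Num.sqrt (z.1 ^+ 2 + z.2 ^+ 2) : R) @^-1` `]-oo, r[).
  by apply: mf => //; exact: measurable_itv.
by rewrite setTI; apply/seteqP; split=> z; rewrite /= in_itv.
Qed.

(* The second argument of [mnormalize] is the value taken when the disk is
   empty; it plays no role for [0 < r]. *)
Definition uniform_disk (R : realType) (r : R) : probability (plane R) R :=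
  mnormalize (mrestr (@lebesgue2 R) (measurable_disk r))
    (\d_ ((0, 0) : plane R)).

(* Lower bounds on the probability of [E] are stated through a measurable
   subset of [E], because [P E] is a junk value when [E] is not measurable; for
   a measurable [E] this is just [p <= P E]. *)
Definition prob_ge (d : measure_display) (T : measurableType d) (R : realType)
    (P : probability T R) (E : set T) (p : R) : Prop :=
  exists A : set T, [/\ measurable A, A `<=` E & (p%:E <= P A)%E].

Definition complex_rv (d : measure_display) (T : measurableType d)
    (R : realType) (X : T -> R[i]) : Prop :=
  measurable_fun setT (fun w => complex.Re (X w)) /\
  measurable_fun setT (fun w => complex.Im (X w)).

Section RandomPoints.
Context (R : realType) (d : nat -> measure_display)
  (T : forall n, measurableType (d n)) (P : forall n, probability (T n) R).

(* [K alpha] is the implicit constant in P(E_n) >= 1 - O_alpha(n^-alpha). *)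
Definition with_overwhelming_probability (K : R -> R)
    (E : forall n, set (T n)) : Prop :=
  forall alpha : R, 0 < alpha -> forall n : nat, K alpha < n%:R ->
    prob_ge (P n) (E n) (1 - K alpha * n%:R `^ (- alpha)).

Context (X : forall n, 'I_n -> T n -> R[i]).

Definition upper_bound (C : R) (K : R -> R) : Prop :=
  with_overwhelming_probability K (fun n => [set w |
    \big[Num.max/0]_(i < n) modulus (X i w) <= expR (n%:R `^ C)]).

(* Z is the second coordinate of the product space [T n * plane R]: this makes
   it uniform on the disk and independent of X_1, ..., X_n. The convention
   [0^-1 = 0] only matters on the null event that Z is one of the X_i. *)
Definition anti_concentration (C : R) (b K : R -> R) : Prop :=
  forall a : R, 0 < a -> forall n : nat, K a < n%:R ->
    prob_ge (P n \x uniform_disk (n%:R `^ C))%E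
      [set wz : T n * plane R |
        n%:R `^ (- b a) <= modulus (\sum_(i < n) (toC wz.2 - X i wz.1)^-1)]
      (1 - K a * n%:R `^ (- a)).

End RandomPoints.

Definition e1 {R : realType} : R * R := (1, 0).
Definition e2 {R : realType} : R * R := (0, 1).

Definition is_C1 (R : realType) (f : R * R -> R) : Prop :=
  [/\ forall z, derivable f z e1, forall z, derivable f z e2,
      continuous ('D_e1 f) & continuous ('D_e2 f)].

Definition is_C2 (R : realType) (f : R * R -> R) : Prop :=
  [/\ is_C1 f, is_C1 ('D_e1 f) & is_C1 ('D_e2 f)].

Definition laplacian (R : realType) (phi : R[i] -> R) (z : R * R) : R :=
  'D_e1 ('D_e1 (phi \o @toC R)) z + 'D_e2 ('D_e2 (phi \o @toC R)) z.

Definition L1norm_laplacian (R : realType) (phi : R[i] -> R) : R :=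
  fine (Lnorm (@lebesgue2 R) 1%E (fun z => (laplacian phi z)%:E)).

Definition admissible_test (R : realType) (C : R) (n : nat) (phi : R[i] -> R)
    : Prop :=
  [/\ is_C2 (phi \o @toC R),
      forall z, n%:R `^ C <= modulus z -> phi z = 0 &
      forall z, `|laplacian phi z| <= n%:R `^ C].

(* The roots of [p^`()], listed with multiplicity. *)
Definition critical_points (R : realType) (p : {poly R[i]}) : seq R[i] :=
  sval (closed_field_poly_normal p^`()).

(* Main.v *)
(* Let S(z) = sum_i 1 / (z - X_i) = p'(z) / p(z). For compactly supported C^2
   functions, int ln |z - w| (lap phi)(z) dz = c0 phi(w) with c0 = 2 pi, so that
   c0 (sum_j phi(w_j) - sum_i phi(X_i)) is the integral of
   (ln |S(z)| - ln n) (lap phi)(z).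
   By anti-concentration, Fubini and Markov, with high probability the set of z
   in the disk with |S(z)| < n^-b has tiny measure, and so has the set of z close
   to some X_i; elsewhere |ln |S(z)|| = O(ln n), which gives the first error
   term. On the exceptional set one expands ln |S(z)| - ln n as the sum of the
   ln |z - w_j| minus the sum of the ln |z - X_i| and uses that all these
   functions have polynomially bounded L^2 norm on the disk, because
   |X_i| <= exp (n^C) and, by Gauss-Lucas, |w_j| <= exp (n^C).
   The potential formula is obtained from Green's identity, i.e. Fubini and the
   one-dimensional fundamental theorem of calculus, for
   ln (|z - w|^2 + e^2) / 2, by letting e tend to 0. *)

Require Import Defs.
From HB Require Import structures.
From mathcomp Require Import all_boot all_order all_algebra.
From mathcomp Require Import complex.
From mathcomp Require Import all_classical all_reals all_analysis.
From mathcomp Require Import measurable_realfun ring lra.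

Set Implicit Arguments.
Unset Strict Implicit.
Unset Printing Implicit Defensive.

Import Order.TTheory GRing.Theory Num.Theory.
Import numFieldNormedType.Exports.

Local Open Scope classical_set_scope.
Local Open Scope ring_scope.

(** * Measurability and affine substitution in the plane *)

(** Only logarithms of distances enter, so points as large as [expR r], with [r] equal to n^C, still
    contribute L^2 norms that are polynomial in [r]. A power of n can thus be absorbed by an
    exceptional set whose measure is a sufficiently negative power of n. Anti-concentration offers
    every exponent [a], and its price [b a] only enters the constant in front of ln n.
    Cauchy-Schwarz on the exceptional set is replaced by the pointwise inequality |l| <= T/2 +
    l^2/(2T), with T a power of n: one explicit majorant is then integrated term by term. The
    exponents are fixed backwards: T beats the L^2 norms, then the measure of the exceptional set
    beats T. The term ln n comes from the leading coefficient of p' and stays inside the integrand,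
    where it only changes the constant of the logarithmic bound. Probability serves only to select a
    good sample; from there on the estimate is deterministic, and the selected event does not depend
    on the test function. Integrals over the plane are reduced to one-variable integrals by working
    with boxes, squares and product majorants instead of polar coordinates. *)

Lemma open_measurable_plane (R : realType) (U : set (R * R)) :
  open U -> measurable (U : set (plane R)).
Proof.
move=> oU.
(* The product sigma-algebra is generated by rectangles, so [U] is written as the union of those
   boxes with rational centre and radius 1/(n+1) that it contains, a countable family. *)
pose box (a b : rat) (n : nat) : set (plane R) :=
  ball (ratr a : R) n.+1%:R^-1 `*` ball (ratr b : R) n.+1%:R^-1.
rewrite (_ : U = \bigcup_a \bigcup_b \bigcup_n
    (if `[< box a b n `<=` U >] then box a b n else set0)).
  apply: bigcupT_measurable_rat => a; apply: bigcupT_measurable_rat => b.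
  apply: bigcupT_measurable => n; case: ifP => // _.
  by apply: measurableX; exact: measurable_ball.
apply/seteqP; split => [z Uz|z [a _ [b _ [n _]]]]; last first.
  by case: ifPn => // /asboolP; exact.
have /nbhs_ballP[e /= e0 eU] : nbhs z U by exact: open_nbhs_nbhs.
have [n _ /(_ n (leqnn n)) /= ne] :=
  near_infty_natSinv_lt (PosNum (divr_gt0 e0 (ltr0n R 2))).
have n0 : 0 < n.+1%:R^-1 :> R by rewrite invr_gt0.
have dr (x : R) : exists q : rat, `|ratr q - x| < n.+1%:R^-1.
  have := @rat_in_itvoo R (x - n.+1%:R^-1) (x + n.+1%:R^-1).
  case; first by rewrite ltrBlDr -addrA ltrDl addr_gt0.
  by move=> q; rewrite in_itv/= => /andP[h1 h2]; exists q; rewrite ltr_distl; apply/andP.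
have [a za] := dr z.1; have [b zb] := dr z.2.
exists a => //; exists b => //; exists n => //.
rewrite ifT; first by split.
apply/asboolP => t [/= ta tb]; apply: eU; move: ne za zb ta tb.
move: (n.+1%:R^-1) => d ne za zb ta tb; split => /=.
- by move: za ta; rewrite /ball/= !ltr_distl => /andP[? ?] /andP[? ?]; apply/andP; split; lra.
- by move: zb tb; rewrite /ball/= !ltr_distl => /andP[? ?] /andP[? ?]; apply/andP; split; lra.
Qed.

Lemma continuous_measurable_plane (R : realType) (f : R * R -> R) :
  continuous f -> measurable_fun [set: plane R] (f : plane R -> R).
Proof.
move=> /continuousP cf; apply: (measurability _ (RGenOpens.measurableE R)).
move=> _ [_ [a [b ->] <-]]; rewrite setTI; apply: open_measurable_plane.
exact/cf/interval_open.
Qed.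

Definition aff (R : realType) (w : R * R) (e : R) (u : plane R) : plane R :=
  (w.1 + e * u.1, w.2 + e * u.2).

Lemma measurable_aff1 (R : realType) (w e : R) :
  measurable_fun [set: measurableTypeR R] (fun x => w + e * x : measurableTypeR R).
Proof. by apply: measurable_funD => //; apply: measurable_funM. Qed.

Lemma measurable_aff (R : realType) (w : R * R) (e : R) :
  measurable_fun [set: plane R] (aff w e).
Proof.
apply: measurable_fun_pair.
- by apply: (measurableT_comp (measurable_aff1 w.1 e)); exact: measurable_fst.
- by apply: (measurableT_comp (measurable_aff1 w.2 e)); exact: measurable_snd.
Qed.

(** The image measure multiplied by [e] agrees with Lebesgue measure on intervals, which determines
    it. The planar version argues in the same way with rectangles and the uniqueness of the product
    measure. *)
Lemma lebesgue_measure_aff (R : realType) (w e : R) (e0 : 0 < e) (A : set R) :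
  measurable A ->
  lebesgue_measure ((fun x : R => w + e * x) @^-1` A) = ((e^-1)%:E * lebesgue_measure A)%E.
Proof.
move=> mA.
have ei0 : 0 < e^-1 by rewrite invr_gt0.
pose f : measurableTypeR R -> measurableTypeR R := fun x => w + e * x.
pose p : {measure set (measurableTypeR R) -> \bar R} :=
  measure_function_pushforward__canonical__measure_function_Measure
    (@lebesgue_measure R) (measurable_aff1 w e).
pose m : {measure set (measurableTypeR R) -> \bar R} :=
  mscale (NngNum (ltW e0)) p.
have mE B : m B = (e%:E * lebesgue_measure (f @^-1` B))%E by [].
have -> : lebesgue_measure A = m A.
  apply: (@lebesgue_measure_unique _ m) => // _ [[a b]] _ <-; rewrite mE.
  rewrite (_ : f @^-1` _ = `](a - w) / e, (b - w) / e]%classic); last first.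
    apply/seteqP; split => x /=; rewrite !in_itv/= /f ltr_pdivrMr// ler_pdivlMr//;
      by move=> /andP[? ?]; apply/andP; split; lra.
  rewrite [RHS]/= !lebesgue_measure_itv/= !lte_fin ltr_pM2r// ltrD2r.
  case: ifPn => _; last by rewrite mule0.
  by rewrite -!EFinB -EFinM; congr EFin; field; rewrite gt_eqF.
by rewrite mE muleA -EFinM mulVf ?gt_eqF// mul1e.
Qed.

Lemma lebesgue2_aff (R : realType) (w : R * R) (e : R) (e0 : 0 < e) (A : set (plane R)) :
  measurable A ->
  (lebesgue2 R A = (e ^+ 2)%:E * lebesgue2 R (aff w e @^-1` A))%E.
Proof.
move=> mA.
pose p : {measure set (plane R) -> \bar R} :=
  measure_function_pushforward__canonical__measure_function_Measure
    (@lebesgue2 R) (measurable_aff w e).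
have e20 : 0 <= e ^+ 2 by exact: sqr_ge0.
pose m : {measure set (plane R) -> \bar R} := mscale (NngNum e20) p.
have mE B : m B = ((e ^+ 2)%:E * lebesgue2 R (aff w e @^-1` B))%E by [].
rewrite -mE; apply: product_measure_unique => // B C mB mC; rewrite mE.
rewrite (_ : aff w e @^-1` (B `*` C) =
   ((fun x => w.1 + e * x) @^-1` B) `*` ((fun x => w.2 + e * x) @^-1` C))//.
have mp (v : R) (D : set R) : measurable D -> measurable ((fun x : R => v + e * x) @^-1` D).
  by move=> mD; rewrite -[X in measurable X]setTI; exact: (measurable_aff1 v e).
rewrite [lebesgue2 R _]product_measure1E; [|exact: mp..].
rewrite [X in (_ * (X * _))%E](lebesgue_measure_aff w.1 e0 mB).
rewrite [X in (_ * (_ * X))%E](lebesgue_measure_aff w.2 e0 mC).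
rewrite (muleACA (e^-1)%:E) -EFinM (muleA (e ^+ 2)%:E) -EFinM.
by rewrite (_ : _ ^+ 2 * _ = 1) ?mul1e//; field; rewrite gt_eqF.
Qed.

(** Zooming in on [w] at scale [e] turns the Laplacian of the regularized logarithm into a fixed
    kernel. The case of nonnegative functions gives the general one through positive and negative
    parts. *)
Lemma integral_aff (R : realType) (w : R * R) (e : R) (e0 : 0 < e) (f : plane R -> R) :
  measurable_fun setT f ->
  (\int[@lebesgue2 R]_z (f z)%:E = \int[@lebesgue2 R]_u (e ^+ 2 * f (aff w e u))%:E)%E.
Proof.
move=> mf.
pose p : {measure set (plane R) -> \bar R} :=
  measure_function_pushforward__canonical__measure_function_Measure
    (@lebesgue2 R) (measurable_aff w e).
have e20 : 0 <= e ^+ 2 by exact: sqr_ge0.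
pose m : {measure set (plane R) -> \bar R} := mscale (NngNum e20) p.
have main (g : plane R -> R) : measurable_fun setT g -> (forall z, 0 <= g z) ->
  (\int[@lebesgue2 R]_z (g z)%:E = \int[@lebesgue2 R]_u (e ^+ 2 * g (aff w e u))%:E)%E.
  move=> mg g0.
  have mge : measurable_fun setT (EFin \o g) by exact/measurable_EFinP.
  rewrite (eq_measure_integral m); last by move=> A mA _; exact: lebesgue2_aff.
  rewrite ge0_integral_mscale//; last by move=> z _; rewrite lee_fin.
  rewrite (ge0_integral_pushforward (measurable_aff w e))//; last first.
    by move=> z _; rewrite lee_fin.
  rewrite preimage_setT -ge0_integralZl//.
  - exact: (measurableT_comp mge (measurable_aff w e)).
  - by move=> z _; rewrite lee_fin.
rewrite [LHS]integralE.
have mfe : measurable_fun setT (EFin \o f) by exact/measurable_EFinP.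
have fpE : (fun z => (f z)%:E)^\+%E = (fun z => (Num.max (f z) 0)%:E).
  by apply/funext => z; rewrite funeposE EFin_max.
have fnE : (fun z => (f z)%:E)^\-%E = (fun z => (Num.max (- f z) 0)%:E).
  by apply/funext => z; rewrite funenegE EFin_max.
rewrite fpE fnE (main (fun z => Num.max (f z) 0)); last 2 first.
- by apply: measurable_maxr.
- by move=> z; rewrite le_max lexx orbT.
rewrite (main (fun z => Num.max (- f z) 0)); last 2 first.
- by apply: measurable_maxr => //; exact: measurable_funN.
- by move=> z; rewrite le_max lexx orbT.
rewrite [RHS]integralE; congr (_ - _)%E; apply: eq_integral => z _.
- by rewrite funeposE -EFin_max maxr_pMr// mulr0.
- by rewrite funenegE -EFinN -EFin_max -mulrN maxr_pMr// mulr0.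
Qed.

(** * Green's identity *)

Lemma is_derive_fst (R : realType) (f : R * R -> R) (x y : R) :
  derivable f (x, y) e1 -> is_derive x 1 (fun t => f (t, y)) ('D_e1 f (x, y)).
Proof.
have E : (fun h : R => h^-1 *: ((f \o shift (x, y)) (h *: e1) - f (x, y))) =
    (fun h => h^-1 *: (((fun t => f (t, y)) \o shift x) (h *: 1) - f (x, y))).
  apply/funext => h; rewrite /= /shift/= /e1.
  by rewrite (_ : h *: (1, 0) + (x, y) = (h *: 1 + x, y))//; congr pair; rewrite /= scaler0 add0r.
by rewrite /derivable E => df; split; rewrite // /derive -E.
Qed.

Lemma is_derive_snd (R : realType) (f : R * R -> R) (x y : R) :
  derivable f (x, y) e2 -> is_derive y 1 (fun t => f (x, t)) ('D_e2 f (x, y)).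
Proof.
have E : (fun h : R => h^-1 *: ((f \o shift (x, y)) (h *: e2) - f (x, y))) =
    (fun h => h^-1 *: (((fun t => f (x, t)) \o shift y) (h *: 1) - f (x, y))).
  apply/funext => h; rewrite /= /shift/= /e2.
  by rewrite (_ : h *: (0, 1) + (x, y) = (x, h *: 1 + y))//; congr pair; rewrite /= scaler0 add0r.
by rewrite /derivable E => df; split; rewrite // /derive -E.
Qed.

Lemma integral_derive_support (R : realType) (F f : R -> R) (M : R) :
  0 < M -> (forall x : R, is_derive x 1 F (f x)) -> continuous f ->
  (forall x, M <= `|x| -> F x = 0) -> (forall x, M <= `|x| -> f x = 0) ->
  (\int[@lebesgue_measure R]_x (f x)%:E = 0)%E.
Proof.
move=> M0 dF cf F0 f0.
have cF : continuous F.
  move=> x; apply: differentiable_continuous; apply/derivable1_diffP.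
  by case: (dF x).
transitivity (\int[@lebesgue_measure R]_(x in `[(- M)%R, M]) (f x)%:E)%E.
  rewrite [RHS]integral_mkcond; apply: eq_integral => x _.
  rewrite patchE; case: ifPn => // /negP xM; rewrite f0// leNgt; apply/negP => xM'.
  by apply: xM; rewrite inE/= in_itv/=; move: xM'; rewrite ltr_norml => /andP[/ltW -> /ltW ->].
rewrite (@continuous_FTC2 _ f F); first 1 last.
- lra.
- exact: continuous_subspaceT.
- split; first by move=> x _; case: (dF x).
  + exact: cvg_at_right_filter (cF _).
  + exact: cvg_at_left_filter (cF _).
- by move=> x _; rewrite derive1E; case: (dF x).
by rewrite !F0 ?subee// ?normrN ger0_norm// ltW.
Qed.

Lemma continuous_support_bounded (R : realType) (F : R * R -> R) (M : R) :
  continuous F -> (forall z : R * R, M <= `|z.1| \/ M <= `|z.2| -> F z = 0) ->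
  exists N, forall z, `|F z| <= N.
Proof.
move=> cF F0; pose B : set (R * R) := `[- M, M] `*` `[- M, M].
have : compact (F @` B).
  apply: continuous_compact; first exact: continuous_subspaceT.
  by apply: compact_setX; exact: segment_compact.
move=> /compact_bounded [N [_ NB]]; exists (`|N| + 1) => z.
have N1 : N < `|N| + 1 by rewrite (le_lt_trans (ler_norm _))// ltrDl.
have [?|z1] := leP M `|z.1|; first by rewrite F0 ?normr0 ?addr_ge0//; left.
have [?|z2] := leP M `|z.2|; first by rewrite F0 ?normr0 ?addr_ge0//; right.
apply: (NB _ N1); exists z => //; split; rewrite /= in_itv/=.
- by move: z1; rewrite ltr_norml => /andP[/ltW -> /ltW ->].
- by move: z2; rewrite ltr_norml => /andP[/ltW -> /ltW ->].
Qed.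

Lemma continuous_box_integrable (R : realType) (F : R * R -> R) (M : R) :
  continuous F -> (forall z : R * R, M <= `|z.1| \/ M <= `|z.2| -> F z = 0) ->
  (@lebesgue2 R).-integrable setT (fun z => (F z)%:E).
Proof.
move=> cF F0; have [N NF] := continuous_support_bounded cF F0.
pose B : set (plane R) := `[- M, M] `*` `[- M, M].
have mB : measurable B by apply: measurableX.
have mF := continuous_measurable_plane cF.
have -> : (fun z : plane R => (F z)%:E) = (EFin \o F) \_ B.
  apply/funext => z; rewrite patchE; case: ifPn => // /negP zM; rewrite F0//.
  have [?|z1] := leP M `|z.1|; [by left|]; have [?|z2] := leP M `|z.2|; [by right|].
  exfalso; apply: zM; rewrite inE/=; split; rewrite /= in_itv/=.
  - by move: z1; rewrite ltr_norml => /andP[/ltW -> /ltW ->].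
  - by move: z2; rewrite ltr_norml => /andP[/ltW -> /ltW ->].
rewrite -integrable_mkcond//; apply: measurable_bounded_integrable => //.
- apply: (@le_lt_trans _ _ (@lebesgue2 R (`[- M, M] `*` `[- M, M]))) => //.
  rewrite [lebesgue2 R _]product_measure1E//= lebesgue_measure_itv/=.
  by case: ifP => _; rewrite ?mule0 ?ltry// -EFinB -EFinM ltry.
- exact: measurable_funTS.
- exists N; split; first exact: num_real.
  move=> x Nx z _; exact: le_trans (NF _) (ltW Nx).
Qed.

Lemma integral_plane0_fst (R : realType) (F : R * R -> R) :
  (@lebesgue2 R).-integrable setT (fun z => (F z)%:E) ->
  (forall y, \int[@lebesgue_measure R]_x (F (x, y))%:E = 0)%E ->
  (\int[@lebesgue2 R]_z (F z)%:E = 0)%E.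
Proof.
move=> iF F0; rewrite -integral21_prod_meas1//.
by rewrite /fubini_G; under eq_integral do rewrite F0; rewrite integral0.
Qed.

Lemma integral_plane0_snd (R : realType) (F : R * R -> R) :
  (@lebesgue2 R).-integrable setT (fun z => (F z)%:E) ->
  (forall x, \int[@lebesgue_measure R]_y (F (x, y))%:E = 0)%E ->
  (\int[@lebesgue2 R]_z (F z)%:E = 0)%E.
Proof.
move=> iF F0; rewrite -integral12_prod_meas1//.
by rewrite /fubini_F; under eq_integral do rewrite F0; rewrite integral0.
Qed.

Lemma is_derive_green (R : realType) (u u1 u2 v v1 v2 : R -> R) (x : R) :
  is_derive x 1 u (u1 x) -> is_derive x 1 u1 (u2 x) ->
  is_derive x 1 v (v1 x) -> is_derive x 1 v1 (v2 x) ->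
  is_derive x 1 (fun t => v t * u1 t - v1 t * u t) (v x * u2 x - v2 x * u x).
Proof.
move=> du du1 dv dv1.
have := is_deriveB (is_deriveM dv du1) (is_deriveM dv1 du).
move/is_derive_eq; apply; rewrite /GRing.scale/=; ring.
Qed.

Lemma derive_near0 (R : realType) (f : R * R -> R) (v z : R * R) :
  (\forall t \near z, f t = 0) -> 'D_v f z = 0.
Proof.
move=> f0; transitivity ('D_v (cst (0 : R)) z); last exact: derive_cst.
exact: near_eq_derive.
Qed.

Lemma deriv_support (R : realType) (f : R * R -> R) (M : R) (v : R * R) :
  (forall z : R * R, M <= `|z.1| \/ M <= `|z.2| -> f z = 0) ->
  forall z : R * R, M < `|z.1| \/ M < `|z.2| -> 'D_v f z = 0.
Proof.
move=> f0 z [|] Mz; apply: derive_near0.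
- have : \forall t \near z, M < `|t.1|.
    have c : continuous (fun t : R * R => `|t.1|).
      by move=> t; apply: (@continuous_comp _ _ _ fst (fun x : R => `|x|));
        [exact: cvg_fst|exact: norm_continuous].
    exact: (c z _ (lt_nbhsr Mz)).
  by apply: filterS => t /ltW ?; rewrite f0//; left.
- have : \forall t \near z, M < `|t.2|.
    have c : continuous (fun t : R * R => `|t.2|).
      by move=> t; apply: (@continuous_comp _ _ _ snd (fun x : R => `|x|));
        [exact: cvg_snd|exact: norm_continuous].
    exact: (c z _ (lt_nbhsr Mz)).
  by apply: filterS => t /ltW ?; rewrite f0//; right.
Qed.

Lemma derive_bound_lipschitz (R : realType) (h dh : R -> R) (a b N : R) :
  (forall x : R, is_derive x 1 h (dh x)) ->
  (forall x, Num.min a b <= x <= Num.max a b -> `|dh x| <= N) ->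
  `|h b - h a| <= N * `|b - a|.
Proof.
move=> dhE.
have ch : continuous h.
  move=> x; apply: differentiable_continuous; apply/derivable1_diffP.
  by case: (dhE x).
wlog ab : a b / a <= b.
  move=> H bN; have [/H|/ltW/H] := leP a b; first by apply.
  by rewrite distrC (distrC a); apply; rewrite minC maxC.
rewrite min_l// max_r// => bN.
have [|c cab ->] := @MVT_segment R h dh a b ab (fun x _ => dhE x).
  exact: continuous_subspaceT.
by rewrite normrM ler_wpM2r// bN//; move: cab; rewrite in_itv.
Qed.

(** [is_C1] only provides partial derivatives. These are bounded near [z], so [f] is Lipschitz along
    a vertical and then a horizontal segment joining [z] to a nearby point. *)
Lemma C1_continuous (R : realType) (f : R * R -> R) : is_C1 f -> continuous f.
Proof.
move=> [d1 d2 c1 c2] z.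
have bnd (g : R * R -> R) : continuous g -> \forall t \near z, `|g t| <= `|g z| + 1.
  move=> cg.
  have cng : continuous (fun t => `|g t|).
    by move=> t; apply: (@continuous_comp _ _ _ g (fun x : R => `|x|));
      [exact: cg|exact: norm_continuous].
  have gN' : `|g z| < `|g z| + 1 by rewrite ltrDl.
  have := cng z _ (lt_nbhsl gN').
  by apply: (@filterS _ (nbhs z) _ [set t | `|g t| < `|g z| + 1]) => t /= /ltW.
have [N N0 [d d0 dN]] : exists2 N : R, 0 < N & exists2 d : R, 0 < d & forall t, ball z d t ->
    `|'D_e1 f t| <= N /\ `|'D_e2 f t| <= N.
  have n1 := bnd _ c1; have n2 := bnd _ c2.
  exists (`|'D_e1 f z| + `|'D_e2 f z| + 1); first by rewrite ltr_wpDl// addr_ge0.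
  have /nbhs_ballP[d /= d0 dN] : \forall t \near z,
    `|'D_e1 f t| <= `|'D_e1 f z| + 1 /\ `|'D_e2 f t| <= `|'D_e2 f z| + 1.
    by apply: filterS2 n1 n2 => t.
  exists d => // t /dN[h1 h2]; split; first by rewrite (le_trans h1)// lerD2r lerDl.
  by rewrite (le_trans h2)// lerD2r lerDr.
apply/cvgrPdist_le => e e0.
(* With this radius each of the two segments contributes at most [e / 2]. *)
have de0 : 0 < Num.min d (e / (2 * N)) by rewrite lt_min d0 divr_gt0// mulr_gt0.
have nb : \forall t \near z, ball z (Num.min d (e / (2 * N))) t.
  exact: (nbhsx_ballx z _ de0).
apply: filterS nb => t [].
move: dN {bnd}; case: z t => [x y] [x' y'] /= dN.
rewrite /ball/= !lt_min => /andP[t1 t1e] /andP[t2 t2e].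
have b1 : `|f (x, y') - f (x', y')| <= N * `|x - x'|.
  apply: (@derive_bound_lipschitz R (fun t => f (t, y')) (fun t => 'D_e1 f (t, y'))).
    by move=> s; exact: is_derive_fst.
  move=> s; rewrite ge_min le_max => /andP[/orP s1 /orP s2].
  apply: (dN (s, y') _).1; split; rewrite /ball//=.
  clear - t1 s1 s2.
  by move: t1; rewrite !ltr_distl => /andP[? ?]; apply/andP; split; case: s1; case: s2; lra.
have b2 : `|f (x, y) - f (x, y')| <= N * `|y - y'|.
  apply: (@derive_bound_lipschitz R (fun t => f (x, t)) (fun t => 'D_e2 f (x, t))).
    by move=> s; exact: is_derive_snd.
  move=> s; rewrite ge_min le_max => /andP[/orP s1 /orP s2].
  apply: (dN (x, s) _).2; split; rewrite /ball//= ?subrr ?normr0//.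
  clear - t2 s1 s2.
  by move: t2; rewrite !ltr_distl => /andP[? ?]; apply/andP; split; case: s1; case: s2; lra.
rewrite -[_ - _](subrKA (f (x, y'))) (le_trans (ler_normD _ _))//.
have h (a : R) : a < e / (2 * N) -> N * a <= e / 2.
  move=> /ltW ae; rewrite (le_trans (ler_wpM2l (ltW N0) ae))//.
  by rewrite le_eqVlt; apply/orP; left; apply/eqP; field; rewrite gt_eqF.
have := h _ t1e; have := h _ t2e; lra.
Qed.

(** Each differentiation turns a closed region of vanishing into an open one. The margin 1 leaves
    room for two such losses, with [M + 1 / 2] in between. *)
Lemma derive_supp2 (R : realType) (f : R * R -> R) (M : R) (v w : R * R) :
  (forall z : R * R, M <= `|z.1| \/ M <= `|z.2| -> f z = 0) ->
  forall z : R * R, M + 1 <= `|z.1| \/ M + 1 <= `|z.2| -> ('D_v f z = 0) * ('D_w ('D_v f) z = 0).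
Proof.
move=> f0 z Mz; split; first by apply: (deriv_support _ f0); case: Mz => ?; [left|right]; lra.
apply: (@deriv_support _ _ (M + 1 / 2) w); last by case: Mz => ?; [left|right]; lra.
by move=> t Mt; apply: (deriv_support _ f0); case: Mt => ?; [left|right]; lra.
Qed.

Lemma continuous_pairl (R : realType) (y : R) : continuous (fun x : R => (x, y)).
Proof.
by move=> x; have H := (cvg_pair (@cvg_id _ (nbhs x)) (@cvg_cst _ y _ (nbhs x) _)); exact: H.
Qed.

Lemma continuous_pairr (R : realType) (x : R) : continuous (fun y : R => (x, y)).
Proof.
by move=> y; have H := (cvg_pair (@cvg_cst _ x _ (nbhs y) _) (@cvg_id _ (nbhs y))); exact: H.
Qed.

(** In each variable separately, g f'' - g'' f is the derivative of g f' - g' f, which is compactly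
    supported because f is. Its integral along every line is therefore 0, and Fubini concludes
    without boundary terms. No support condition on [g] is involved, so [g] may be a logarithm. *)
Lemma green_identity (R : realType) (f g g1 g2 g11 g22 : R * R -> R) (M : R) :
  is_C2 f -> (forall z : R * R, M <= `|z.1| \/ M <= `|z.2| -> f z = 0) -> 0 < M ->
  (forall x y, is_derive (x : R) 1 (fun t => g (t, y)) (g1 (x, y))) ->
  (forall x y, is_derive (x : R) 1 (fun t => g1 (t, y)) (g11 (x, y))) ->
  (forall x y, is_derive (y : R) 1 (fun t => g (x, t)) (g2 (x, y))) ->
  (forall x y, is_derive (y : R) 1 (fun t => g2 (x, t)) (g22 (x, y))) ->
  continuous g -> continuous g11 -> continuous g22 ->
  (\int[@lebesgue2 R]_z (g z * ('D_e1 ('D_e1 f) z + 'D_e2 ('D_e2 f) z))%:E =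
   \int[@lebesgue2 R]_z (f z * (g11 z + g22 z))%:E)%E.
Proof.
move=> [C1f C1f1 C1f2] f0 M0 dg1 dg11 dg2 dg22 cg cg11 cg22.
have cf := C1_continuous C1f.
have [df1 df2 _ _] := C1f; have [df11 _ cf11 _] := C1f1; have [_ df22 _ cf22] := C1f2.
have f10 := derive_supp2 e1 e1 f0; have f20 := derive_supp2 e2 e2 f0.
have f0' z : M + 1 <= `|z.1| \/ M + 1 <= `|z.2| -> f z = 0.
  by move=> Mz; apply: f0; case: Mz => ?; [left|right]; lra.
pose F1 z := g z * 'D_e1 ('D_e1 f) z - g11 z * f z.
pose F2 z := g z * 'D_e2 ('D_e2 f) z - g22 z * f z.
have contM (h k : R * R -> R) : continuous h -> continuous k -> continuous (fun z => h z * k z).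
  by move=> ch ck z; apply: cvgM; [exact: ch|exact: ck].
have contB (h k : R * R -> R) : continuous h -> continuous k -> continuous (fun z => h z - k z).
  by move=> ch ck z; apply: cvgB; [exact: ch|exact: ck].
have cF1 : continuous F1 := contB _ _ (contM _ _ cg cf11) (contM _ _ cg11 cf).
have cF2 : continuous F2 := contB _ _ (contM _ _ cg cf22) (contM _ _ cg22 cf).
have F10 z : M + 1 <= `|z.1| \/ M + 1 <= `|z.2| -> F1 z = 0.
  by move=> Mz; rewrite /F1 f10// f0'// !mulr0 subrr.
have F20 z : M + 1 <= `|z.1| \/ M + 1 <= `|z.2| -> F2 z = 0.
  by move=> Mz; rewrite /F2 f20// f0'// !mulr0 subrr.
have c_sec1 (h : R * R -> R) y : continuous h -> continuous (fun x => h (x, y)).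
  by move=> ch x; exact: (continuous_comp (@continuous_pairl R y x) (ch _)).
have c_sec2 (h : R * R -> R) x : continuous h -> continuous (fun y => h (x, y)).
  by move=> ch y; exact: (continuous_comp (@continuous_pairr R x y) (ch _)).
have iF1 := continuous_box_integrable cF1 F10.
have iF2 := continuous_box_integrable cF2 F20.
have I1 : (\int[@lebesgue2 R]_z (F1 z)%:E = 0)%E.
  apply: integral_plane0_fst => // y.
  apply: (@integral_derive_support R
    (fun x => g (x, y) * 'D_e1 f (x, y) - g1 (x, y) * f (x, y)) _ (M + 1)).
  - by rewrite addr_gt0.
  - move=> x; exact: (@is_derive_green R (fun x => f (x, y)) (fun x => 'D_e1 f (x, y))
      (fun x => 'D_e1 ('D_e1 f) (x, y)) (fun x => g (x, y)) (fun x => g1 (x, y))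
      (fun x => g11 (x, y)) x (is_derive_fst (df1 _)) (is_derive_fst (df11 _))
      (dg1 x y) (dg11 x y)).
  - exact: c_sec1.
  - by move=> x Mx; rewrite f0' ?f10 ?mulr0 ?subrr//; left.
  - by move=> x Mx; rewrite F10//; left.
have I2 : (\int[@lebesgue2 R]_z (F2 z)%:E = 0)%E.
  apply: integral_plane0_snd => // x.
  apply: (@integral_derive_support R
    (fun y => g (x, y) * 'D_e2 f (x, y) - g2 (x, y) * f (x, y)) _ (M + 1)).
  - by rewrite addr_gt0.
  - move=> y; exact: (@is_derive_green R (fun y => f (x, y)) (fun y => 'D_e2 f (x, y))
      (fun y => 'D_e2 ('D_e2 f) (x, y)) (fun y => g (x, y)) (fun y => g2 (x, y))
      (fun y => g22 (x, y)) y (is_derive_snd (df2 _)) (is_derive_snd (df22 _))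
      (dg2 x y) (dg22 x y)).
  - exact: c_sec2.
  - by move=> y My; rewrite f0' ?f20 ?mulr0 ?subrr//; right.
  - by move=> y My; rewrite F20//; right.
have cH : continuous (fun z => f z * (g11 z + g22 z)).
  have cD : continuous (fun z => g11 z + g22 z).
    by move=> z; exact: (cvgD (cg11 z) (cg22 z)).
  exact: contM cf cD.
have iH : (@lebesgue2 R).-integrable setT (fun z => (f z * (g11 z + g22 z))%:E).
  by apply: (@continuous_box_integrable _ _ (M + 1) cH) => z Mz; rewrite f0' ?mul0r.
have E z : ((g z * ('D_e1 ('D_e1 f) z + 'D_e2 ('D_e2 f) z))%:E =
    (F1 z)%:E + (F2 z)%:E + (f z * (g11 z + g22 z))%:E)%E.
  rewrite -!EFinD /F1 /F2; congr EFin.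
  move: (g z) (f z) (g11 z) (g22 z) ('D_e1 ('D_e1 f) z) ('D_e2 ('D_e2 f) z).
  by clear=> *; ring.
under eq_integral do rewrite E.
rewrite integralD//; last exact: integrableD.
by rewrite integralD// I1 I2 !add0e.
Qed.

(** * Square integrability of the logarithm *)

(* Majorizes ln^2 near 0, up to a factor 16, while being integrable in one
   real variable; this makes polar coordinates unnecessary. *)
Definition sing (R : realType) (t : R) : R :=
  if (0 < `|t|) && (`|t| < 1) then (Num.sqrt `|t|)^-1 else 0.

Lemma sing_ge0 (R : realType) (t : R) : 0 <= sing t.
Proof. by rewrite /sing; case: ifP => // _; rewrite invr_ge0 sqrtr_ge0. Qed.

Lemma measurable_sing (R : realType) : measurable_fun [set: R] (@sing R).
Proof.
have mn : measurable_fun [set: R] (fun t : R => `|t|) by exact: normr_measurable.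
apply: measurable_fun_ifT => //.
- by apply: measurable_and; apply: measurable_fun_ltr.
- have -> : (fun t : R => (Num.sqrt `|t|)^-1) = (fun t => `|t| `^ (- (2^-1))).
    by apply/funext => t; rewrite powRN powR12_sqrt.
  by apply: (measurableT_comp (measurable_powR _)).
Qed.

(** The antiderivative 2 sqrt x is differentiable only away from 0, hence the cut-off [a]; the bound
    does not depend on it, which allows a passage to the limit. *)
Lemma integral_inv_sqrt (R : realType) (a : R) : 0 < a -> a < 1 ->
  (\int[@lebesgue_measure R]_(x in `[a, 1%R]) ((Num.sqrt x)^-1)%:E <= 2%:E)%E.
Proof.
move=> a0 a1.
have pos x : x \in `[a, 1] -> 0 < x by rewrite in_itv/= => /andP[+ _]; exact: lt_le_trans.
have posoo x : x \in `]a, 1[ -> 0 < x.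
  by rewrite in_itv/= => /andP[+ _]; exact: lt_trans.
have dF (x : R) : 0 < x -> is_derive x 1 (fun x => 2 * Num.sqrt x) (Num.sqrt x)^-1.
  move=> x0; have := is_derive1_sqrt x0 => ds.
  apply: is_derive_eq; rewrite /GRing.scale/= invfM; field.
  by rewrite gt_eqF// sqrtr_gt0.
have cs : continuous (@Num.sqrt R) by exact: sqrt_continuous.
rewrite (@continuous_FTC2 _ _ (fun x => 2 * Num.sqrt x))//.
- by rewrite sqrtr1 mulr1 -EFinB lee_fin gerBl mulr_ge0 ?sqrtr_ge0.
- apply: continuous_in_subspaceT => x /set_mem/= xa; apply: cvgV; last exact: cs.
  by rewrite gt_eqF// sqrtr_gt0 pos.
- split.
  + by move=> x /posoo /dF[].
  + by apply: cvg_at_right_filter; apply: cvgM; [exact: cvg_cst|exact: cs].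
  + by apply: cvg_at_left_filter; apply: cvgM; [exact: cvg_cst|exact: cs].
- by move=> x /posoo /dF[_]; rewrite derive1E.
Qed.

Lemma integral_sing (R : realType) :
  (\int[@lebesgue_measure R]_x (sing x)%:E <= 4%:E)%E.
Proof.
have ms := @measurable_sing R.
have mse (D : set R) : measurable D -> measurable_fun D (fun x => (sing x)%:E).
  by move=> mD; apply/measurable_EFinP; exact: measurable_funTS.
have s0 (x : R) : (0 <= (sing x)%:E)%E by rewrite lee_fin sing_ge0.
have pos : (\int[@lebesgue_measure R]_(x in `[0%R, +oo[) (sing x)%:E <= 2%:E)%E.
  (* Monotone convergence along intervals that avoid the singularity; the lower ends 1/(k+2) are all
     below 1, as [integral_inv_sqrt] requires. *)
  pose F (k : nat) : set R := `[k.+2%:R^-1, 1]%classic.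
  have -> : (\int[@lebesgue_measure R]_(x in `[0%R, +oo[) (sing x)%:E =
             \int[@lebesgue_measure R]_(x in \bigcup_k F k) (if x < 1 then sing x else 0)%:E)%E.
    rewrite integral_mkcond [RHS]integral_mkcond; apply: eq_integral => x _.
    rewrite !patchE; case: ifPn => x0; case: ifPn => // xF.
    - case: ltP => // x1; rewrite /sing (ltNge `|x|) ger0_norm ?x1 ?andbF//.
      by rewrite (le_trans _ x1).
    - rewrite /sing; case: ifP => // /andP[xx1 xx2]; exfalso.
      move: x0 xx1 xx2; rewrite inE/= in_itv/= andbT => x0; rewrite ger0_norm// => {}x0 x1.
      move/negP: xF; apply; rewrite inE.
      have [k _ /(_ k (leqnn k)) /= ke] := near_infty_natSinv_lt (PosNum x0).
      exists k => //; rewrite /F/= in_itv/= (ltW x1) andbT (le_trans _ (ltW ke))//.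
      by rewrite lef_pV2 ?posrE// ler_nat.
    - exfalso; move/negP: x0; apply; move: xF; rewrite !inE => -[k _].
      rewrite /F/= !in_itv/= => /andP[kx _].
      by rewrite andbT (le_trans _ kx)// invr_ge0.
  have mF k : measurable (F k) by exact: measurable_itv.
  have mG : measurable_fun setT (fun x : R => (if x < 1 then sing x else 0)%:E).
    apply/measurable_EFinP; apply: measurable_fun_ifT => //.
    by apply: measurable_fun_ltr.
  have ndF : nondecreasing_seq F.
    move=> i j ij; apply/subsetPset => x; rewrite /F/= !in_itv/= => /andP[ix ->]; rewrite andbT.
    by rewrite (le_trans _ ix)// lef_pV2 ?posrE// ler_nat.
  have G0 (x : R) : (0 <= (if x < 1 then sing x else 0)%:E)%E.
    by rewrite lee_fin; case: ifP => // _; exact: sing_ge0.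
  have cv := @ge0_nondecreasing_set_cvg_integral _ (measurableTypeR R) R F
    (fun x => (if x < 1 then sing x else 0)%:E) (@lebesgue_measure R) ndF mF
    (fun i => measurable_funTS mG) (fun i x _ => G0 x).
  rewrite -(cvg_lim _ cv)//; apply: lime_le; first by apply/cvg_ex; eexists; exact: cv.
  apply: nearW => k; have k0 : 0 < k.+2%:R^-1 :> R by rewrite invr_gt0.
  have k1 : k.+2%:R^-1 < 1 :> R by rewrite invf_lt1// ltr1n.
  apply: le_trans (integral_inv_sqrt k0 k1).
  apply: ge0_le_integral => //.
  - exact: mF.
  - exact: measurable_funTS.
  - apply/measurable_EFinP; apply: measurable_funTS.
    have -> : (fun t : R => (Num.sqrt t)^-1) = (fun t => Num.max 0 t `^ (- (2^-1))).
      apply/funext => t; rewrite powRN powR12_sqrt ?le_max ?lexx//; congr _^-1.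
      by have [//|t0] := leP 0 t; rewrite sqrtr0 ler0_sqrtr// ltW.
    apply: (measurableT_comp (measurable_powR _)).
    by apply: measurable_maxr.
  - move=> x; rewrite /F/= in_itv/= => /andP[kx x1]; rewrite lee_fin.
    have x0 : 0 < x by exact: lt_le_trans kx.
    case: ifPn => [{}x1|_]; last by rewrite invr_ge0 sqrtr_ge0.
    by rewrite /sing gtr0_norm// x0 x1.
have neg : (\int[@lebesgue_measure R]_(x in `]-oo, 0%R]) (sing x)%:E <= 2%:E)%E.
  rewrite (_ : (\int[_]_(x in _) _)%E =
      \int[@lebesgue_measure R]_(x in `]-oo, 0%R]) (sing (- x)%R)%:E)%E.
    by rewrite -(@ge0_integration_by_substitution0 R (fun x => (sing x)%:E))//; exact: mse.
  by apply: eq_integral => x _; rewrite /sing normrN.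
rewrite (_ : [set: _] = `]-oo, 0%R] `|` `]0%R, +oo[); last first.
  apply/esym; rewrite -subTset => x _ /=; rewrite !in_itv/= andbT.
  by have [?|?] := leP x 0; [left|right].
rewrite ge0_integral_setU//=; last 2 first.
- by apply: mse; exact: measurableU.
- by apply/disj_setPS => x [/=]; rewrite !in_itv/= andbT leNgt => /negP.
rewrite (_ : 4%:E = 2%:E + 2%:E)%E; last by rewrite -EFinD; congr EFin; lra.
apply: leeD => //; apply: le_trans pos; apply: ge0_subset_integral => //.
- exact: mse.
- by move=> x /=; rewrite !in_itv/= !andbT => /ltW.
Qed.

Definition box (R : realType) (r : R) : set (plane R) :=
  `[- r, r]%classic `*` `[- r, r]%classic.

Lemma measurable_box (R : realType) (r : R) : measurable (box r).
Proof. by apply: measurableX; exact: measurable_itv. Qed.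

Lemma box_measure (R : realType) (r : R) : 0 < r ->
  @lebesgue2 R (box r) = (4 * r ^+ 2)%:E.
Proof.
move=> r0; rewrite [lebesgue2 R _]product_measure1E; [|exact: measurable_itv..].
have E : @lebesgue_measure R `[- r, r]%classic = (2 * r)%:E.
  rewrite lebesgue_measure_itv/= lte_fin ifT; last by lra.
  by rewrite -EFinB; congr EFin; ring.
rewrite [X in (X * _)%E]E [X in (_ * X)%E]E -EFinM; congr EFin; ring.
Qed.

Lemma integral_translate (R : realType) (a : R) (h : R -> R) :
  measurable_fun setT h -> (forall x, 0 <= h x) ->
  (\int[@lebesgue_measure R]_x (h (x - a))%:E = \int[@lebesgue_measure R]_x (h x)%:E)%E.
Proof.
move=> mh h0.
pose p : {measure set (measurableTypeR R) -> \bar R} :=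
  measure_function_pushforward__canonical__measure_function_Measure
    (@lebesgue_measure R) (@measurable_aff1 R (- a) 1).
rewrite [RHS](eq_measure_integral p); last first.
  move=> A mA _; rewrite [RHS](lebesgue_measure_aff (- a) ltr01 mA).
  by rewrite invr1 mul1e.
transitivity (\int[@lebesgue_measure R]_(x in (fun x : R => - a + 1 * x)%R @^-1` setT)
  (EFin \o h) (- a + 1 * x)%R)%E.
  by apply: eq_integral => x _; rewrite /= mul1r addrC.
have mhe : measurable_fun setT (EFin \o h) by exact/measurable_EFinP.
have h0e : {in setT, forall x : measurableTypeR R, (0 <= (EFin \o h) x)%E}.
  by move=> x _; rewrite lee_fin.
exact/esym/(@ge0_integral_pushforward _ _ _ _ _ _ (@measurable_aff1 R (- a) 1)).
Qed.

(** Only the second coordinate is cut off to [-r, r]. Letting the first one run over the whole line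
    can only increase the integral, since [h] is nonnegative, and makes the integrand a product. *)
Lemma integral_box_fst (R : realType) (r : R) (h : R -> R) : 0 < r ->
  measurable_fun setT h -> (forall x, 0 <= h x) ->
  (\int[@lebesgue2 R]_(z in box r) (h z.1)%:E <=
   (2 * r)%:E * \int[@lebesgue_measure R]_x (h x)%:E)%E.
Proof.
move=> r0 mh h0; have mB := measurable_box r.
pose I : set R := `[- r, r]%classic.
have mI : measurable I by exact: measurable_itv.
have mh1 : measurable_fun [set: plane R] (fun z => h z.1).
  exact: (measurableT_comp mh measurable_fst).
have mi2 : measurable_fun [set: plane R] (fun z => \1_I z.2 : R).
  by apply: (measurableT_comp _ measurable_snd); exact: measurable_indic.
pose H (z : plane R) := h z.1 * \1_I z.2.
have mH : measurable_fun setT (fun z => (H z)%:E).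
  by apply/measurable_EFinP; exact: measurable_funM.
have E : @lebesgue_measure R I = (2 * r)%:E.
  rewrite /I lebesgue_measure_itv/= lte_fin ifT; last by lra.
  by rewrite -EFinB; congr EFin; ring.
have mind : measurable_fun [set: measurableTypeR R] (fun y => (\1_I y : R)%:E).
  by apply/measurable_EFinP; exact: measurable_indic.
have H0 z : (0 <= (H z)%:E)%E by rewrite lee_fin mulr_ge0.
have mhe : measurable_fun [set: measurableTypeR R] (fun x => (h x)%:E).
  exact/measurable_EFinP.
rewrite integral_mkcond.
apply: (@le_trans _ _ (\int[@lebesgue2 R]_z (H z)%:E)%E).
  apply: ge0_le_integral => //.
  - by move=> z _; apply: erestrict_ge0 => t _; rewrite lee_fin.
  - by apply/(measurable_restrictT _ mB); apply/measurable_EFinP; exact: measurable_funTS.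
  - move=> z _; rewrite patchE; case: ifPn => [|_]; last by rewrite lee_fin mulr_ge0.
    by rewrite inE => -[_ z2]; rewrite lee_fin /H indicE mem_set// mulr1.
rewrite (fubini_tonelli1 _ mH); last exact: H0.
rewrite /fubini_F -ge0_integralZl//; last 2 first.
- by move=> x _; rewrite lee_fin.
- by rewrite lee_fin mulr_ge0// ltW.
apply: ge0_le_integral => //.
- by move=> x _; apply: integral_ge0 => y _; rewrite lee_fin mulr_ge0.
- exact: (measurable_fun_fubini_tonelli_F _ mH H0).
- by apply: measurable_funeM; exact: mhe.
- move=> x _; rewrite /H/=.
  under eq_integral do rewrite EFinM.
  rewrite ge0_integralZl ?lee_fin//.
  by rewrite integral_indic// setIT muleC [X in (X * _)%E]E.
Qed.

Lemma integral_box_snd (R : realType) (r : R) (h : R -> R) : 0 < r ->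
  measurable_fun setT h -> (forall x, 0 <= h x) ->
  (\int[@lebesgue2 R]_(z in box r) (h z.2)%:E <=
   (2 * r)%:E * \int[@lebesgue_measure R]_x (h x)%:E)%E.
Proof.
move=> r0 mh h0; have mB := measurable_box r.
pose I : set R := `[- r, r]%classic.
have mI : measurable I by exact: measurable_itv.
have mh1 : measurable_fun [set: plane R] (fun z => h z.2).
  exact: (measurableT_comp mh measurable_snd).
have mi2 : measurable_fun [set: plane R] (fun z => \1_I z.1 : R).
  by apply: (measurableT_comp _ measurable_fst); exact: measurable_indic.
pose H (z : plane R) := h z.2 * \1_I z.1.
have mH : measurable_fun setT (fun z => (H z)%:E).
  by apply/measurable_EFinP; exact: measurable_funM.
have E : @lebesgue_measure R I = (2 * r)%:E.
  rewrite /I lebesgue_measure_itv/= lte_fin ifT; last by lra.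
  by rewrite -EFinB; congr EFin; ring.
have mind : measurable_fun [set: measurableTypeR R] (fun y => (\1_I y : R)%:E).
  by apply/measurable_EFinP; exact: measurable_indic.
have H0 z : (0 <= (H z)%:E)%E by rewrite lee_fin mulr_ge0.
have mhe : measurable_fun [set: measurableTypeR R] (fun x => (h x)%:E).
  exact/measurable_EFinP.
rewrite integral_mkcond.
apply: (@le_trans _ _ (\int[@lebesgue2 R]_z (H z)%:E)%E).
  apply: ge0_le_integral => //.
  - by move=> z _; apply: erestrict_ge0 => t _; rewrite lee_fin.
  - by apply/(measurable_restrictT _ mB); apply/measurable_EFinP; exact: measurable_funTS.
  - move=> z _; rewrite patchE; case: ifPn => [|_]; last by rewrite lee_fin mulr_ge0.
    by rewrite inE => -[z2 _]; rewrite lee_fin /H indicE mem_set// mulr1.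
rewrite (fubini_tonelli2 _ mH); last exact: H0.
rewrite /fubini_G -ge0_integralZl//; last 2 first.
- by move=> x _; rewrite lee_fin.
- by rewrite lee_fin mulr_ge0// ltW.
apply: ge0_le_integral => //.
- by move=> x _; apply: integral_ge0 => y _; rewrite lee_fin mulr_ge0.
- exact: (measurable_fun_fubini_tonelli_G _ mH H0).
- by apply: measurable_funeM; exact: mhe.
- move=> x _; rewrite /H/=.
  under eq_integral do rewrite EFinM.
  rewrite ge0_integralZl ?lee_fin//.
  by rewrite integral_indic// setIT muleC [X in (X * _)%E]E.
Qed.

(** With t = s^4 one has |ln t| = 4 ln (1/s) <= 4/s, and squaring gives 16/s^2, where s^2 = sqrt
    t. *)
Lemma sqr_ln_le (R : realType) (t : R) : 0 < t -> t < 1 -> ln t ^+ 2 <= 16 * (Num.sqrt t)^-1.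
Proof.
move=> t0 t1; have l0 : ln t <= 0 by rewrite ln_le0 ?ltW.
pose s := Num.sqrt (Num.sqrt t).
have s0 : 0 < s by rewrite !sqrtr_gt0.
have ss : s ^+ 2 = Num.sqrt t by rewrite sqr_sqrtr ?sqrtr_ge0.
have st : s ^+ 4 = t by rewrite (exprM s 2 2) ss sqr_sqrtr ?ltW.
have lE : ln t = - (4 * ln s^-1).
  by rewrite lnV// mulrN opprK -{1}st lnXn// mulr_natl.
have ls : 0 <= ln s^-1.
  by rewrite -(@pmulr_rge0 _ 4)//; lra.
have ls' : ln s^-1 <= s^-1 by apply: ltW; apply: ln_sublinear; rewrite invr_gt0.
rewrite lE sqrrN exprMn -ss -exprVn.
have := ler_pM ls ls ls' ls'; rewrite -!expr2.
by move: (ln _ ^+ 2) (s^-1 ^+ 2) => ? ?; lra.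
Qed.

(** If |z - w| >= 1, its logarithm lies between 0 and [L]. Otherwise |z - w| lies between a nonzero
    coordinate offset and 1, so ln^2 |z - w| is at most ln^2 of that offset: a singularity at a
    point of the plane is majorized by functions of one variable. *)
Lemma sqr_ln_modulus_le (R : realType) (L : R) (w : R[i]) (z : R * R) : 0 <= L ->
  modulus (toC z - w) <= expR L ->
  ln (modulus (toC z - w)) ^+ 2 <=
  L ^+ 2 + 16 * (sing (z.1 - complex.Re w) + sing (z.2 - complex.Im w)).
Proof.
move=> L0.
have S1 := sing_ge0 (z.1 - complex.Re w); have S2 := sing_ge0 (z.2 - complex.Im w).
case: z w S1 S2 => [x y] [a b] /= S1 S2; rewrite /modulus/=.
set s := Num.sqrt _ => sL.
have [s1|s1] := leP 1 s.
  have l0 : 0 <= ln s by exact: ln_ge0.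
  have lL : ln s <= L by rewrite -(expRK L) ler_ln// posrE ?expR_gt0// (lt_le_trans ltr01).
  by have := ler_pM l0 l0 lL lL; rewrite -!expr2; lra.
have key (t : R) : 0 < `|t| -> `|t| <= s -> ln s ^+ 2 <= 16 * sing t.
  move=> t0 ts; have t1 : `|t| < 1 by exact: le_lt_trans s1.
  rewrite /sing t0 t1 /=; apply: le_trans (sqr_ln_le t0 t1).
  have l1 : ln `|t| <= ln s by rewrite ler_ln// posrE// (lt_le_trans t0).
  have l2 : ln s <= 0 by rewrite ln_le0// ltW.
  rewrite -sqrrN -(sqrrN (ln `|t|)) ler_sqr ?nnegrE ?oppr_ge0// ?lerN2//.
  exact: le_trans l2.
have sx : `|x - a| <= s by rewrite /s -sqrtr_sqr ler_wsqrtr// lerDl sqr_ge0.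
have sy : `|y - b| <= s by rewrite /s -sqrtr_sqr ler_wsqrtr// lerDr sqr_ge0.
have L2 : 0 <= L ^+ 2 by exact: sqr_ge0.
have [xa|xa] := eqVneq (x - a) 0; last first.
  by have := key _ _ sx; rewrite normr_gt0 => /(_ xa); lra.
have [yb|yb] := eqVneq (y - b) 0; last first.
  by have := key _ _ sy; rewrite normr_gt0 => /(_ yb); lra.
(* At z = w itself the convention [ln 0 = 0] makes the left side vanish. *)
have -> : s = 0 by rewrite /s xa yb expr0n/= addr0 sqrtr0.
by rewrite ln0// expr0n/=; lra.
Qed.

Lemma measurable_ln_modulus (R : realType) (w : R[i]) :
  measurable_fun [set: plane R] (fun z => ln (modulus (toC z - w)) : R).
Proof.
apply: (measurableT_comp (@measurable_ln R)).
have -> : (fun z : plane R => modulus (toC z - w)) =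
   (fun z => Num.sqrt ((z.1 - complex.Re w) ^+ 2 + (z.2 - complex.Im w) ^+ 2)).
  by apply/funext => -[x y]; case: w => a b.
apply: (measurableT_comp (continuous_measurable_fun (@sqrt_continuous R))).
by apply: measurable_funD; apply: measurable_funX; apply: measurable_funB.
Qed.

(** The area of the box is [4 * r ^+ 2]. Each coordinate adds at most [2 * r] times 16 times the
    bound 4 of [integral_sing], that is [128 * r]. *)
Lemma integral_sqr_ln (R : realType) (r L : R) (w : R[i]) : 0 < r -> 0 <= L ->
  (forall z, box r z -> modulus (toC z - w) <= expR L) ->
  (\int[@lebesgue2 R]_(z in box r) (ln (modulus (toC z - w)) ^+ 2)%:E <=
   (4 * r ^+ 2 * L ^+ 2 + 256 * r)%:E)%E.
Proof.
move=> r0 L0 wL; have mB := measurable_box r.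
pose h1 (x : R) := 16 * sing (x - complex.Re w).
pose h2 (x : R) := 16 * sing (x - complex.Im w).
have mh a : measurable_fun [set: R] (fun x => 16 * sing (x - a)).
  apply: measurable_funM => //; apply: (measurableT_comp (@measurable_sing R)).
  exact: measurable_funB.
have h0 a x : 0 <= 16 * sing (x - a) :> R by rewrite mulr_ge0// sing_ge0.
have ih a : (\int[@lebesgue_measure R]_x (16 * sing (x - a))%:E <= 64%:E)%E.
  under eq_integral do rewrite EFinM.
  rewrite ge0_integralZl//; last first.
  - by move=> x _; rewrite lee_fin sing_ge0.
  - apply/measurable_EFinP; apply: (measurableT_comp (@measurable_sing R)).
    exact: measurable_funB.
  rewrite (integral_translate a (@measurable_sing R) (@sing_ge0 R)).
  rewrite (_ : 64%:E = 16%:E * 4%:E)%E; last by rewrite -EFinM; congr EFin; lra.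
  by rewrite lee_wpmul2l// integral_sing.
have m1 : measurable_fun (box r) (fun z : plane R => (h1 z.1)%:E).
  apply/measurable_EFinP; apply: measurable_funTS.
  exact: (measurableT_comp (mh _) measurable_fst).
have m2 : measurable_fun (box r) (fun z : plane R => (h2 z.2)%:E).
  apply/measurable_EFinP; apply: measurable_funTS.
  exact: (measurableT_comp (mh _) measurable_snd).
apply: (@le_trans _ _ (\int[@lebesgue2 R]_(z in box r)
    ((L ^+ 2)%:E + ((h1 z.1)%:E + (h2 z.2)%:E)))%E).
  apply: ge0_le_integral => //.
  - by move=> z _; rewrite lee_fin sqr_ge0.
  - apply/measurable_EFinP; apply: measurable_funTS; apply: measurable_funX.
    exact: measurable_ln_modulus.
  - by apply: emeasurable_funD => //; exact: emeasurable_funD.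
  - move=> z Bz; rewrite -!EFinD lee_fin /h1 /h2 -mulrDr.
    exact: sqr_ln_modulus_le (wL _ Bz).
rewrite ge0_integralD//; last 3 first.
- by move=> z _; rewrite lee_fin sqr_ge0.
- by move=> z _; rewrite adde_ge0// lee_fin h0.
- exact: emeasurable_funD.
rewrite integral_cst// box_measure// ge0_integralD//; last 2 first.
- by move=> z _; rewrite lee_fin h0.
- by move=> z _; rewrite lee_fin h0.
rewrite EFinD leeD// -?EFinM ?lee_fin; first by rewrite mulrC.
rewrite (_ : (256 * r)%:E = (2 * r)%:E * 64%:E + (2 * r)%:E * 64%:E)%E; last first.
  by rewrite -!EFinM -EFinD; congr EFin; lra.
have r20 : 0 <= 2 * r by lra.
apply: leeD.
- by apply: le_trans (integral_box_fst r0 (mh _) (h0 _)) _; rewrite lee_wpmul2l// lee_fin.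
- by apply: le_trans (integral_box_snd r0 (mh _) (h0 _)) _; rewrite lee_wpmul2l// lee_fin.
Qed.

(** * Zeros and critical points of a polynomial *)

Section roots.
Context (R : realType).
Local Notation C := R[i].

Lemma deriv_prod_XsubC (n : nat) (x : 'I_n -> C) (z : C) :
  (forall i, z != x i) ->
  (\prod_(i < n) ('X - (x i)%:P))^`().[z] =
  (\prod_(i < n) (z - x i)) * \sum_(i < n) (z - x i)^-1.
Proof.
elim: n x => [|n IH] x zx.
  by rewrite !big_ord0 mulr0 -[1]/(1%:P) derivC horner0.
rewrite !big_ord_recr/= derivM hornerD !hornerM IH// derivXsubC hornerC hornerXsubC.
rewrite horner_prod; under [X in _ + X * 1]eq_bigr do rewrite hornerXsubC.
by rewrite mulr1; field; rewrite subr_eq0.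
Qed.

Lemma deriv_prod_XsubC_lead (n : nat) (x : 'I_n -> C) : (0 < n)%N ->
  let p' := (\prod_(i < n) ('X - (x i)%:P))^`() in
  size p' = n /\ lead_coef p' = n%:R.
Proof.
move=> n0 p'; rewrite /p'; set p := \prod_(i < n) _.
have sp : size p = n.+1 by rewrite /p -big_enum /= size_prod_XsubC size_enum_ord.
have lp : p`_n = 1.
  have /monicP := monic_prod_XsubC (index_enum 'I_n) predT x.
  by rewrite lead_coefE -/p sp.
have sd : size p^`() = n.
  apply/eqP; rewrite eqn_leq; apply/andP; split.
    by rewrite -ltnS -sp lt_size_deriv// -size_poly_eq0 sp.
  rewrite leqNgt; apply/negP => sd.
  have : p^`()`_n.-1 = 0 by rewrite nth_default// -ltnS prednK.
  rewrite coef_deriv prednK// lp => /eqP.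
  by rewrite pnatr_eq0; case: (n) n0.
by split=> //; rewrite lead_coefE sd coef_deriv prednK// lp.
Qed.

(** The factor [n%:R] is the leading coefficient of p'; it is the origin of the term [ln n%:R] in
    [log_derivative]. *)
Lemma deriv_normal (n : nat) (x : 'I_n -> C) (z : C) : (0 < n)%N ->
  (\prod_(i < n) ('X - (x i)%:P))^`().[z] =
  n%:R * \prod_(w <- critical_points (\prod_(i < n) ('X - (x i)%:P))) (z - w).
Proof.
move=> n0; rewrite /critical_points; case: closed_field_poly_normal => /= r pr.
rewrite pr (deriv_prod_XsubC_lead x n0).2 hornerZ horner_prod; congr (_ * _).
by apply: eq_bigr => w _; rewrite hornerXsubC.
Qed.

Lemma size_critical_points (n : nat) (x : 'I_n -> C) : (0 < n)%N ->
  size (critical_points (\prod_(i < n) ('X - (x i)%:P))) = n.-1.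
Proof.
move=> n0; rewrite /critical_points; case: closed_field_poly_normal => /= r pr.
have [sz ld] := deriv_prod_XsubC_lead x n0.
move/(congr1 (fun q : {poly C} => size q)) : pr; rewrite sz ld size_scale.
  by rewrite (size_prod_XsubC r id) => ->.
by rewrite pnatr_eq0 -lt0n.
Qed.

Lemma modulus_ge0 (z : C) : 0 <= modulus z.
Proof. by case: z => a b; exact: sqrtr_ge0. Qed.

Lemma modulus_gt0 (z : C) : (0 < modulus z) = (z != 0).
Proof.
rewrite lt0r modulus_ge0 andbT; congr (~~ _); apply/eqP/eqP => [/Normc.eq0_normc//|->].
by rewrite /modulus Normc.normc0.
Qed.

Lemma modulusM (z w : C) : modulus (z * w) = modulus z * modulus w.
Proof. exact: Normc.normcM. Qed.

Lemma modulus_prod (I : Type) (s : seq I) (F : I -> C) :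
  modulus (\prod_(i <- s) F i) = \prod_(i <- s) modulus (F i).
Proof.
elim: s => [|i s IH]; first by rewrite !big_nil /modulus Normc.normc1.
by rewrite !big_cons modulusM IH.
Qed.

Lemma modulus_nat (n : nat) : modulus (n%:R : C) = n%:R.
Proof. by rewrite /modulus normcMn Normc.normc1. Qed.

Lemma ln_prod (I : eqType) (s : seq I) (F : I -> R) :
  (forall i, i \in s -> 0 < F i) ->
  ln (\prod_(i <- s) F i) = \sum_(i <- s) ln (F i).
Proof.
elim: s => [|i s IH] F0; first by rewrite !big_nil ln1.
rewrite !big_cons lnM ?IH//.
- by move=> j js; apply: F0; rewrite inE js orbT.
- by rewrite posrE F0// mem_head.
- rewrite posrE big_seq; apply: prodr_gt0 => j js.
  by apply: F0; rewrite inE js orbT.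
Qed.

(** Take logarithms of moduli in p'(z) = p(z) S(z). As p(z) and S(z) are nonzero, so is p'(z): no
    logarithm is evaluated at 0, and the products split into sums. *)
Lemma log_derivative (n : nat) (x : 'I_n -> C) (z : C) : (0 < n)%N ->
  (forall i, z != x i) -> \sum_(i < n) (z - x i)^-1 != 0 ->
  \sum_(w <- critical_points (\prod_(i < n) ('X - (x i)%:P))) ln (modulus (z - w))
  - \sum_(i < n) ln (modulus (z - x i)) =
  ln (modulus (\sum_(i < n) (z - x i)^-1)) - ln n%:R.
Proof.
move=> n0 zx S0.
have := deriv_normal x z n0; rewrite deriv_prod_XsubC//.
set cp := critical_points _ => E.
have p0 : \prod_(i < n) (z - x i) != 0.
  by apply/prodf_neq0 => i _; rewrite subr_eq0.
have nC0 : n%:R != 0 :> C by rewrite pnatr_eq0 -lt0n.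
have c0 : \prod_(w <- cp) (z - w) != 0.
  by apply: contraTneq (mulf_neq0 p0 S0) => c0; rewrite E c0 mulr0 eqxx.
have cw w : w \in cp -> 0 < modulus (z - w).
  move=> wc; rewrite modulus_gt0; apply: contraNneq c0 => zw.
  by apply/eqP; rewrite (big_rem w)//= zw mul0r.
have /(congr1 (fun t => ln (modulus t))) := E.
rewrite !modulusM !lnM ?posrE ?modulus_gt0// modulus_nat !modulus_prod.
rewrite !ln_prod//; last by move=> i _; rewrite modulus_gt0 subr_eq0.
move=> h; lra.
Qed.

(** Up to the positive factor 1/|w - x|^2, the real part is |w|^2 minus the scalar product of w and
    x, which exceeds (|w|^2 - |x|^2)/2 or equals it. *)
Lemma Re_ratio_gt0 (w x : C) : modulus x < modulus w ->
  0 < complex.Re (w * (w - x)^-1).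
Proof.
move=> xw.
have wx : w != x by apply: contraTneq xw => ->; rewrite ltxx.
case: w x xw wx => [a b] [c d] /=; rewrite /modulus/= => xw wx.
have ab0 : 0 < a ^+ 2 + b ^+ 2.
  rewrite lt0r addr_ge0 ?sqr_ge0// andbT; apply: contraTneq xw => ->.
  by rewrite sqrtr0 -leNgt sqrtr_ge0.
have {}xw : c ^+ 2 + d ^+ 2 < a ^+ 2 + b ^+ 2 by rewrite -ltr_sqrt.
have D0 : 0 < (a - c) ^+ 2 + (b - d) ^+ 2.
  rewrite lt0r addr_ge0 ?sqr_ge0// andbT paddr_eq0 ?sqr_ge0// !sqrf_eq0 !subr_eq0.
  by apply: contra wx => /andP[/eqP-> /eqP->].
rewrite [X in 0 < X](_ : _ = (a * (a - c) + b * (b - d)) / ((a - c) ^+ 2 + (b - d) ^+ 2)).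
  by apply: divr_gt0 => //; nra.
field; exact: lt0r_neq0.
Qed.

(** Gauss-Lucas for a disk centred at 0. If |w| > M, then every w/(w - x_i) has positive real part,
    so w S(w) cannot vanish; but p'(w) = 0 and p(w) != 0 would force S(w) = 0. *)
Lemma critical_points_bounded (n : nat) (x : 'I_n -> C) (M : R) (w : C) : (0 < n)%N ->
  (forall i, modulus (x i) <= M) ->
  w \in critical_points (\prod_(i < n) ('X - (x i)%:P)) -> modulus w <= M.
Proof.
move=> n0 xM wc; rewrite leNgt; apply/negP => Mw.
have wx i : w != x i.
  by apply: contraTneq Mw => ->; rewrite -leNgt.
have : \sum_(i < n) (w - x i)^-1 = 0.
  have := deriv_normal x w n0; rewrite deriv_prod_XsubC//.
  rewrite (big_rem w)//= subrr mul0r mulr0 => /eqP; rewrite mulf_eq0 => /orP[|/eqP//].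
  by move=> /prodf_eq0[i _]; rewrite subr_eq0 (negPf (wx i)).
move=> /(congr1 (fun t => complex.Re (w * t))); rewrite mulr0 /= mulr_sumr => /eqP.
rewrite (big_morph (@complex.Re R) (id1 := 0) (op1 := +%R))//; last by move=> [? ?] [? ?].
rewrite gt_eqF//; case: n n0 x xM wc wx => // n _ x xM wc wx.
rewrite big_ord_recl ltr_pwDl//; first exact/Re_ratio_gt0/le_lt_trans/Mw.
by apply: sumr_ge0 => i _; exact/ltW/Re_ratio_gt0/le_lt_trans/Mw.
Qed.

End roots.

(** * The logarithmic potential *)

Lemma continuous_sqr (R : realType) (T : topologicalType) (f : T -> R) :
  continuous f -> continuous (fun z => f z ^+ 2).
Proof. by move=> cf z; have H := cvgM (cf z) (cf z); exact: H. Qed.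

Section log_reg.
Context (R : realType).

Let quad (a A x : R) := (x - a) ^+ 2 + A.

Let quad_gt0 (a A x : R) : 0 < A -> 0 < quad a A x.
Proof. by move=> A0; rewrite /quad ltr_wpDl// sqr_ge0. Qed.

Let is_derive_quad (a A x : R) : is_derive x 1 (quad a A) (2 * (x - a)).
Proof.
rewrite /quad; apply: is_derive_eq.
by rewrite /GRing.scale/=; ring.
Qed.

Lemma is_derive_half_ln (a A x : R) : 0 < A ->
  is_derive x 1 (fun t => 2^-1 * ln ((t - a) ^+ 2 + A)) ((x - a) / ((x - a) ^+ 2 + A)).
Proof.
move=> A0; have q0 := quad_gt0 a x A0.
have H := is_derive1_comp (is_derive1_ln q0) (is_derive_quad a A x).
have := is_deriveZ (2^-1) H.
move/is_derive_eq; apply; rewrite /GRing.scale/= /quad; field.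
exact: lt0r_neq0.
Qed.

Lemma is_derive_half_ln2 (a A x : R) : 0 < A ->
  is_derive x 1 (fun t => (t - a) / ((t - a) ^+ 2 + A))
   (((x - a) ^+ 2 + A)^-1 - 2 * (x - a) ^+ 2 / ((x - a) ^+ 2 + A) ^+ 2).
Proof.
move=> A0; have q0 := lt0r_neq0 (quad_gt0 a x A0).
have d1 : is_derive x 1 (fun t : R => t - a) 1.
  by apply: is_derive_eq; rewrite subr0.
have := is_deriveM d1 (is_deriveV q0 (is_derive_quad a A x)).
move/is_derive_eq; apply; rewrite /GRing.scale/= /quad; field.
exact: q0.
Qed.

(* [regq w e] is |z - w|^2 + e^2: half its logarithm is a smooth
   regularization of ln |z - w| with Laplacian 2 e^2 / (|z - w|^2 + e^2)^2. *)
Definition regq (w : R * R) (e : R) (z : R * R) : R :=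
  (z.1 - w.1) ^+ 2 + (z.2 - w.2) ^+ 2 + e ^+ 2.

Lemma regq_gt0 w e z : 0 < e -> 0 < regq w e z.
Proof. by move=> e0; rewrite /regq ltr_wpDl ?exprn_gt0// addr_ge0 ?sqr_ge0. Qed.

Lemma continuous_regq w e : continuous (regq w e).
Proof.
have c1 : continuous (fun z : R * R => z.1 - w.1).
  by move=> z; apply: cvgB; [exact: cvg_fst|exact: cvg_cst].
have c2 : continuous (fun z : R * R => z.2 - w.2).
  by move=> z; apply: cvgB; [exact: cvg_snd|exact: cvg_cst].
move=> z; apply: cvgD; last exact: cvg_cst.
by apply: cvgD; [exact: (continuous_sqr c1)|exact: (continuous_sqr c2)].
Qed.

Lemma log_green (f : R * R -> R) (w : R * R) (e M : R) :
  is_C2 f -> (forall z : R * R, M <= `|z.1| \/ M <= `|z.2| -> f z = 0) -> 0 < M -> 0 < e ->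
  (\int[@lebesgue2 R]_z (2^-1 * ln (regq w e z) * ('D_e1 ('D_e1 f) z + 'D_e2 ('D_e2 f) z))%:E =
   \int[@lebesgue2 R]_z (f z * (2 * e ^+ 2 / regq w e z ^+ 2))%:E)%E.
Proof.
move=> C2f f0 M0 e0.
have e20 : 0 < e ^+ 2 by rewrite exprn_gt0.
have A0 (t : R) : 0 < t ^+ 2 + e ^+ 2 by rewrite ltr_wpDl// sqr_ge0.
have cq := @continuous_regq w e.
have cqV : continuous (fun z => (regq w e z)^-1).
  by move=> z; apply: cvgV; [exact/lt0r_neq0/regq_gt0|exact: cq].
have c1 : continuous (fun z : R * R => (z.1 - w.1) ^+ 2).
  by apply: continuous_sqr => z; apply: cvgB; [exact: cvg_fst|exact: cvg_cst].
have c2 : continuous (fun z : R * R => (z.2 - w.2) ^+ 2).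
  by apply: continuous_sqr => z; apply: cvgB; [exact: cvg_snd|exact: cvg_cst].
have cg (p : R * R -> R) : continuous p ->
    continuous (fun z => (regq w e z)^-1 - 2 * p z / regq w e z ^+ 2).
  move=> cp z; apply: cvgB; first exact: cqV.
  apply: cvgM; first by apply: cvgM; [exact: cvg_cst|exact: cp].
  apply: cvgV; first by rewrite expf_neq0// lt0r_neq0// regq_gt0.
  exact: (continuous_sqr cq).
(* With one coordinate frozen, [regq] is a quadratic (t - a)^2 + A with A > 0, so the one-variable
   derivatives apply. *)
have E1 (y t : R) : (t - w.1) ^+ 2 + ((y - w.2) ^+ 2 + e ^+ 2) = regq w e (t, y).
  by rewrite /regq/= addrA.
have E2 (x t : R) : (t - w.2) ^+ 2 + ((x - w.1) ^+ 2 + e ^+ 2) = regq w e (x, t).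
  by rewrite /regq/= addrCA addrA.
have dg1 (x y : R) : is_derive x 1 (fun t => 2^-1 * ln (regq w e (t, y)))
    ((x - w.1) / regq w e (x, y)).
  have := is_derive_half_ln w.1 x (A0 (y - w.2)).
  by rewrite E1//; under eq_fun do rewrite E1//.
have dg11 (x y : R) : is_derive x 1 (fun t => (t - w.1) / regq w e (t, y))
    ((regq w e (x, y))^-1 - 2 * (x - w.1) ^+ 2 / regq w e (x, y) ^+ 2).
  have := is_derive_half_ln2 w.1 x (A0 (y - w.2)).
  by rewrite E1//; under eq_fun do rewrite E1//.
have dg2 (x y : R) : is_derive y 1 (fun t => 2^-1 * ln (regq w e (x, t)))
    ((y - w.2) / regq w e (x, y)).
  have := is_derive_half_ln w.2 y (A0 (x - w.1)).
  by rewrite E2; under eq_fun do rewrite E2.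
have dg22 (x y : R) : is_derive y 1 (fun t => (t - w.2) / regq w e (x, t))
    ((regq w e (x, y))^-1 - 2 * (y - w.2) ^+ 2 / regq w e (x, y) ^+ 2).
  have := is_derive_half_ln2 w.2 y (A0 (x - w.1)).
  by rewrite E2; under eq_fun do rewrite E2.
have cl : continuous (fun z => 2^-1 * ln (regq w e z)).
  move=> z; apply: cvgM; first exact: cvg_cst.
  apply: (@continuous_comp _ _ _ (regq w e) (@ln R)); first exact: cq.
  by apply: continuous_ln; exact: regq_gt0.
have := @green_identity R f (fun z => 2^-1 * ln (regq w e z))
   (fun z => (z.1 - w.1) / regq w e z) (fun z => (z.2 - w.2) / regq w e z)
   (fun z => (regq w e z)^-1 - 2 * (z.1 - w.1) ^+ 2 / regq w e z ^+ 2)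
   (fun z => (regq w e z)^-1 - 2 * (z.2 - w.2) ^+ 2 / regq w e z ^+ 2) M
   C2f f0 M0 dg1 dg11 dg2 dg22 cl (cg _ c1) (cg _ c2).
move=> ->; apply: eq_integral => z _; congr (_ * _)%:E.
have := lt0r_neq0 (regq_gt0 w z e0).
by rewrite /regq => h; field.
Qed.

(** The Laplacian of the regularized logarithm after the substitution [aff w e], Jacobian [e ^+ 2]
    included. It no longer depends on [e], so these Laplacians form an approximate identity of total
    mass [c0]. *)
Definition kern (u : plane R) : R := 2 / (1 + u.1 ^+ 2 + u.2 ^+ 2) ^+ 2.

Lemma kern_gt0 u : 0 < kern u.
Proof. by rewrite /kern divr_gt0// exprn_gt0// -addrA ltr_pwDl// addr_ge0 ?sqr_ge0. Qed.

Lemma regq_aff (w : R * R) (e : R) (u : plane R) : 0 < e ->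
  e ^+ 2 * (2 * e ^+ 2 / regq w e (aff w e u) ^+ 2) = kern u.
Proof.
move=> e0; rewrite /regq /aff /kern /=.
have q0 : 1 + u.1 ^+ 2 + u.2 ^+ 2 != 0.
  by rewrite lt0r_neq0// -addrA ltr_pwDl// addr_ge0 ?sqr_ge0.
rewrite (_ : _ + e ^+ 2 = e ^+ 2 * (1 + u.1 ^+ 2 + u.2 ^+ 2)); last by ring.
by field; rewrite q0 gt_eqF.
Qed.

Lemma continuous_kern : continuous (kern : R * R -> R).
Proof.
have c : continuous (fun u : R * R => 1 + u.1 ^+ 2 + u.2 ^+ 2).
  have c1 : continuous (fun u : R * R => u.1) by move=> z; exact: cvg_fst.
  have c2 : continuous (fun u : R * R => u.2) by move=> z; exact: cvg_snd.
  move=> z; apply: cvgD; last exact: (continuous_sqr c2).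
  by apply: cvgD; [exact: cvg_cst|exact: (continuous_sqr c1)].
move=> z; rewrite /kern; apply: cvgM; first exact: cvg_cst.
apply: cvgV.
  by rewrite lt0r_neq0// exprn_gt0// -addrA ltr_pwDl// addr_ge0 ?sqr_ge0.
exact: (continuous_sqr c).
Qed.

Lemma measurable_kern : measurable_fun setT kern.
Proof. exact: (continuous_measurable_plane continuous_kern). Qed.

Lemma integral_oneDsqrV_lty :
  (\int[@lebesgue_measure R]_x ((1 + x ^+ 2)^-1)%:E < +oo)%E.
Proof.
have c : continuous (fun x : R => (1 + x ^+ 2)^-1).
  move=> x; apply: cvgV; first by rewrite lt0r_neq0// ltr_pwDl// sqr_ge0.
  by apply: cvgD; [exact: cvg_cst|apply: continuous_sqr => ?; exact: cvg_id].
rewrite (@ge0_symfun_integralT R (fun x => (1 + x ^+ 2)^-1))//; last 2 first.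
- by move=> x; rewrite invr_ge0 addr_ge0// sqr_ge0.
- by move=> x /=; rewrite sqrrN.
have := @integral0y_oneDsqr R; rewrite set_itvcy => ->.
by rewrite -EFinM ltry.
Qed.

(** Since (1 + x^2 + y^2)^2 >= (1 + x^2)(1 + y^2), the kernel is dominated by a product of two
    integrable functions of one variable. *)
Lemma integrable_kern : (@lebesgue2 R).-integrable setT (fun u => (kern u)%:E).
Proof.
have mk : measurable_fun setT (fun u => (kern u)%:E).
  by apply/measurable_EFinP; exact: measurable_kern.
apply/integrable12ltyP => //.
have mp : measurable_fun [set: R] (fun x : R => ((1 + x ^+ 2)^-1)%:E).
  apply/measurable_EFinP; apply: continuous_measurable_fun.
  move=> x; apply: cvgV; first by rewrite lt0r_neq0// ltr_pwDl// sqr_ge0.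
  by apply: cvgD; [exact: cvg_cst|apply: continuous_sqr => ?; exact: cvg_id].
have p0 (x : R) : 0 <= (1 + x ^+ 2)^-1 by rewrite invr_ge0 addr_ge0// sqr_ge0.
set J := (\int[@lebesgue_measure R]_x ((1 + x ^+ 2)^-1)%:E)%E.
have Jlt : (J < +oo)%E := integral_oneDsqrV_lty.
have J0 : (0 <= J)%E by apply: integral_ge0 => x _; rewrite lee_fin.
have Jfin : J \is a fin_num by rewrite ge0_fin_numE.
apply: (@le_lt_trans _ _ (\int[@lebesgue_measure R]_x ((2 * (1 + x ^+ 2)^-1)%:E * J))%E).
  apply: ge0_le_integral => //.
  - by move=> x _; exact: integral_ge0.
  - apply: (measurable_fun_fubini_tonelli_F (fun u => `|(kern u)%:E|%E)) => //.
    exact: measurableT_comp.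
  - apply: emeasurable_funM => //; apply/measurable_EFinP.
    by apply: measurable_funM => //; exact/measurable_EFinP.
  - move=> x _; rewrite /J -ge0_integralZl//; last 2 first.
    + by move=> y _; rewrite lee_fin.
    + by rewrite lee_fin mulr_ge0.
    apply: ge0_le_integral => //.
    + apply: measurableT_comp => //; exact: (measurableT_comp mk (pair1_measurable x)).
    + by apply: measurable_funeM.
    + move=> y _; rewrite gee0_abs ?lee_fin ?(ltW (kern_gt0 _))//; rewrite /kern/=.
      rewrite -mulrA ler_wpM2l// -invfM lef_pV2 ?posrE; last 2 first.
      * by rewrite exprn_gt0// -addrA ltr_pwDl// addr_ge0 ?sqr_ge0.
      * by rewrite mulr_gt0// ltr_pwDl// sqr_ge0.
      by have := sqr_ge0 x; have := sqr_ge0 y; move: (x ^+ 2) (y ^+ 2) => a b; nra.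
under eq_integral do rewrite muleC EFinM muleA.
rewrite ge0_integralZl//; last 2 first.
- by move=> x _; rewrite lee_fin.
- by rewrite mule_ge0.
by rewrite -/J -ge0_fin_numE ?fin_numM// mule_ge0// mule_ge0.
Qed.

(* The value is 2 pi, but only its positivity matters. *)
Definition c0 : R := fine (\int[@lebesgue2 R]_u (kern u)%:E).

Lemma c0E : (\int[@lebesgue2 R]_u (kern u)%:E = c0%:E)%E.
Proof. by rewrite /c0 fineK//; exact: integrable_fin_num integrable_kern. Qed.

Lemma c0_gt0 : 0 < c0.
Proof.
rewrite -lte_fin -c0E.
have mk (D : set (plane R)) : measurable_fun D (fun u => (kern u)%:E).
  by apply/measurable_EFinP; apply: measurable_funTS measurable_kern.
have mB := measurable_box (1 : R).
(* On the box of half-side 1 the denominator of [kern] is at most 3^2 = 9. *)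
apply: (@lt_le_trans _ _ (\int[@lebesgue2 R]_(u in box 1) (2 / 9)%:E)%E).
  by rewrite integral_cst// box_measure// -EFinM lte_fin; lra.
apply: (@le_trans _ _ (\int[@lebesgue2 R]_(u in box 1) (kern u)%:E)%E); last first.
  apply: ge0_subset_integral => //.
  by move=> u _; rewrite lee_fin ltW// kern_gt0.
apply: ge0_le_integral => //.
move=> u [/=]; rewrite !in_itv/= => /andP[u1 u2] /andP[u3 u4].
  rewrite lee_fin /kern ler_pM2l// lef_pV2 ?posrE//; last first.
    by rewrite exprn_gt0// -addrA ltr_pwDl// addr_ge0 ?sqr_ge0.
  have := sqr_ge0 u.1; have := sqr_ge0 u.2.
  have : u.1 ^+ 2 <= 1 by nra.
  have : u.2 ^+ 2 <= 1 by nra.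
  by move: (u.1 ^+ 2) (u.2 ^+ 2) => a b; nra.
Qed.

End log_reg.

Lemma abs_fst_le_modulus (R : realType) (z : R * R) : `|z.1| <= modulus (toC z).
Proof. by rewrite /modulus/= -sqrtr_sqr ler_wsqrtr// lerDl sqr_ge0. Qed.

Lemma abs_snd_le_modulus (R : realType) (z : R * R) : `|z.2| <= modulus (toC z).
Proof. by rewrite /modulus/= -sqrtr_sqr ler_wsqrtr// lerDr sqr_ge0. Qed.

Lemma modulus_toC_le (R : realType) (z : R * R) : modulus (toC z) <= `|z.1| + `|z.2|.
Proof.
rewrite /modulus/= -(ger0_norm (addr_ge0 (normr_ge0 z.1) (normr_ge0 z.2))) -sqrtr_sqr.
rewrite ler_wsqrtr// sqrrD !real_normK ?num_real// addrAC lerDl.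
by rewrite mulrn_wge0// mulr_ge0.
Qed.

Lemma modulusB_le (R : realType) (r : R) (w : R[i]) (z : R * R) : box r z ->
  modulus (toC z - w) <= 2 * r + modulus w.
Proof.
move=> [/=]; rewrite !in_itv/= => z1 z2.
apply: (le_trans (le_normcD _ _)); rewrite normcN lerD2r.
by apply: (le_trans (modulus_toC_le z)); rewrite mulr_natl mulr2n lerD// ler_norml.
Qed.

Lemma integrable_sqr_ln (R : realType) (r : R) (w : R[i]) : 0 < r ->
  (@lebesgue2 R).-integrable (box r) (fun z => (ln (modulus (toC z - w)) ^+ 2)%:E).
Proof.
move=> r0; apply/integrableP; split.
  apply/measurable_EFinP; apply: measurable_funTS; apply: measurable_funX.
  exact: measurable_ln_modulus.
(* As m <= exp m, the bound m on |z - w| can itself serve as the parameter [L] of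
   [integral_sqr_ln]. *)
have m0 : 0 <= 2 * r + modulus w by rewrite addr_ge0 ?modulus_ge0// mulr_ge0// ltW.
under eq_integral do rewrite gee0_abs ?lee_fin ?sqr_ge0//.
apply: le_lt_trans (ltry _); apply: (integral_sqr_ln r0 m0) => z Bz.
apply: (le_trans (modulusB_le w Bz)); apply: le_trans (expR_ge1Dx _).
by rewrite lerDr.
Qed.

(** Discards the pole: there the regularized logarithms tend to minus infinity, whereas [ln 0] is
    0. *)
Lemma ae_neq_plane (R : realType) (v : R * R) :
  {ae @lebesgue2 R, forall z : plane R, z <> v}.
Proof.
exists ([set v.1] `*` [set v.2]); split.
- by apply: measurableX; exact: measurable_set1.
- rewrite [lebesgue2 R _]product_measure1E; [|exact: measurable_set1..].
  by rewrite [X in (X * _)%E]lebesgue_measure_set1 mul0e.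
- by move=> z /= /contrapT ->.
Qed.

Section log_potential.
Context (R : realType) (f : R * R -> R) (M : R).
Context (C2f : is_C2 f) (M0 : 0 < M)
  (f0 : forall z : R * R, M <= `|z.1| \/ M <= `|z.2| -> f z = 0).

Let lap z := 'D_e1 ('D_e1 f) z + 'D_e2 ('D_e2 f) z.

Let lap0 z : M + 1 <= `|z.1| \/ M + 1 <= `|z.2| -> lap z = 0.
Proof.
by move=> Mz; rewrite /lap (derive_supp2 e1 e1 f0 Mz) (derive_supp2 e2 e2 f0 Mz) addr0.
Qed.

Let continuous_lap : continuous lap.
Proof.
have [_ [_ _ c1 _] [_ _ _ c2]] := C2f.
by move=> z; exact: (cvgD (c1 z) (c2 z)).
Qed.

Let e (n : nat) : R := n.+1%:R^-1.

Let e_gt0 n : 0 < e n. Proof. by rewrite invr_gt0. Qed.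

Let e_le1 n : e n <= 1. Proof. by rewrite invf_le1// ler1n. Qed.

Let cvg_e : e @ \oo --> (0 : R). Proof. exact: cvg_harmonic. Qed.

(** After zooming in, the integrand is f(v + e u) kern(u). It tends to f(v) kern(u) by continuity
    and is dominated by a multiple of [kern], since [f] is bounded. *)
Let cvg_kernel (v : R * R) :
  (\int[@lebesgue2 R]_z (f z * (2 * e n ^+ 2 / regq v (e n) z ^+ 2))%:E)%E @[n --> \oo]
  --> (c0 R * f v)%:E.
Proof.
have cf : continuous f by have [/C1_continuous] := C2f.
have [N Nf] := continuous_support_bounded cf f0.
have -> : (c0 R * f v)%:E = (\int[@lebesgue2 R]_u (f v * kern u)%:E)%E.
  under [RHS]eq_integral do rewrite EFinM.
  by rewrite integralZl//; [rewrite c0E mulrC EFinM|exact: integrable_kern].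
have cq n := @continuous_regq R v (e n).
have mF n : measurable_fun [set: plane R]
    (fun z => f z * (2 * e n ^+ 2 / regq v (e n) z ^+ 2)).
  apply: continuous_measurable_plane => z; apply: cvgM; first exact: cf.
  apply: cvgM; first exact: cvg_cst.
  apply: cvgV; last exact: (continuous_sqr (cq n)).
  by rewrite expf_neq0// lt0r_neq0// regq_gt0.
have -> : (fun n => \int[@lebesgue2 R]_z (f z * (2 * e n ^+ 2 / regq v (e n) z ^+ 2))%:E)%E =
    (fun n => \int[@lebesgue2 R]_u (f (aff v (e n) u) * kern u)%:E)%E.
  apply/funext => n; rewrite (integral_aff v (e_gt0 n) (mF n)).
  by apply: eq_integral => u _; rewrite mulrCA (regq_aff v u (e_gt0 n)).
have mfa n : measurable_fun [set: plane R] (fun u => f (aff v (e n) u)).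
  exact: (measurableT_comp (continuous_measurable_plane cf) (measurable_aff v (e n))).
have mk := @measurable_kern R.
have [] := @dominated_convergence _ _ _ (@lebesgue2 R) setT measurableT
  (fun n u => (f (aff v (e n) u) * kern u)%:E) (fun u => (f v * kern u)%:E)
  (fun u => (N * kern u)%:E).
- by move=> n; apply/measurable_EFinP; exact: measurable_funM.
- by apply/measurable_EFinP; exact: measurable_funM.
- apply: aeW => u _; apply/fine_cvgP; split; first exact: nearW.
  apply: cvgM; last exact: cvg_cst.
  apply: (cvg_comp (fun n => aff v (e n) u) f); last exact: cf.
  have a (x y : R) : x + e n * y @[n --> \oo] --> x.
    rewrite -[X in _ --> X]addr0; apply: cvgD; first exact: cvg_cst.
    by rewrite -[X in _ --> X](mul0r y); apply: cvgM; [exact: cvg_e|exact: cvg_cst].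
  have H := cvg_pair (a v.1 u.1) (a v.2 u.2).
  by case: (v) H => ? ?; exact.
- under eq_fun do rewrite EFinM.
  by apply: integrableZl => //; exact: integrable_kern.
- apply: aeW => u n _; rewrite lee_fin normrM (gtr0_norm (kern_gt0 u)).
  by rewrite ler_wpM2r// ltW// kern_gt0.
by [].
Qed.

Let modulusE (w : R[i]) (z : R * R) :
  modulus (toC z - w) ^+ 2 = (z.1 - complex.Re w) ^+ 2 + (z.2 - complex.Im w) ^+ 2.
Proof. by case: w => a b; rewrite /modulus/= sqr_sqrtr// addr_ge0// sqr_ge0. Qed.

(** A majorant independent of [n], for dominated convergence. From above, ln q <= q <= s^2 + 1 where
    s = |z - w|; from below, half of ln q is at least ln s, and (ln s + 1/2)^2 >= 0 gives ln s >= -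
    ln^2 s - 1/4. *)
Let half_ln_le (w : R[i]) (z : R * R) n : z <> (complex.Re w, complex.Im w) ->
  `|2^-1 * ln (regq (complex.Re w, complex.Im w) (e n) z)| <=
  ln (modulus (toC z - w)) ^+ 2 + (2 + modulus (toC z - w) ^+ 2).
Proof.
move=> zw; rewrite /regq/= -modulusE; set s := modulus _.
have s0 : 0 < s.
  rewrite modulus_gt0 subr_eq0; apply: contra_notN zw.
  by case: z w @s => [x y] [a b] /= /eqP[-> ->].
have q0 : 0 < s ^+ 2 + e n ^+ 2 by rewrite addr_gt0// exprn_gt0.
have h1 : ln (s ^+ 2) <= ln (s ^+ 2 + e n ^+ 2).
  by rewrite ler_ln ?posrE ?exprn_gt0// lerDl sqr_ge0.
rewrite lnXn// in h1.
have h2 : ln (s ^+ 2 + e n ^+ 2) <= s ^+ 2 + 1.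
  apply: (le_trans (ltW (ln_sublinear q0))); rewrite lerD2l.
  by rewrite exprn_ile1// ltW.
have h3 : 0 <= (ln s + 2^-1) ^+ 2 by exact: sqr_ge0.
have h4 : 0 <= ln s ^+ 2 by exact: sqr_ge0.
rewrite sqrrD in h3.
have s2 : 0 <= s ^+ 2 by exact: sqr_ge0.
move: h1 h2 h3 h4 s2; rewrite -mulr_natl.
move: (s ^+ 2) (ln s) (ln (s ^+ 2 + e n ^+ 2)) => c b a.
move=> h1 h2 h3 h4 s2; rewrite ler_norml; apply/andP; split; nra.
Qed.

Let cvg_half_ln (w : R[i]) (z : R * R) : z <> (complex.Re w, complex.Im w) ->
  2^-1 * ln (regq (complex.Re w, complex.Im w) (e n) z) @[n --> \oo] -->
  ln (modulus (toC z - w)).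
Proof.
move=> zw; rewrite /regq/= -modulusE; set s := modulus _.
have s0 : 0 < s.
  rewrite modulus_gt0 subr_eq0; apply: contra_notN zw.
  by case: z w @s => [x y] [a b] /= /eqP[-> ->].
rewrite [X in _ --> X](_ : _ = 2^-1 * ln (s ^+ 2)); last first.
  rewrite lnXn//. by rewrite -[ln s *+ 2]mulr_natl mulrA mulVf ?mul1r.
apply: cvgM; first exact: cvg_cst.
apply: (cvg_comp (fun n => s ^+ 2 + e n ^+ 2) (@ln R)); last first.
  by apply: continuous_ln; exact: exprn_gt0.
have H := cvgD (@cvg_cst _ (s ^+ 2) _ \oo _) (cvgM cvg_e cvg_e).
by rewrite mulr0 addr0 in H; exact: H.
Qed.

(** Both sides of [log_green] converge as e tends to 0, the left one to the logarithmic integral and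
    the right one by [cvg_kernel]; the limits of one and the same sequence coincide. *)
Lemma log_potential (w : R[i]) :
  (@lebesgue2 R).-integrable setT (fun z => (ln (modulus (toC z - w)) * lap z)%:E) /\
  (\int[@lebesgue2 R]_z (ln (modulus (toC z - w)) * lap z)%:E =
   (c0 R * f (complex.Re w, complex.Im w))%:E)%E.
Proof.
set v := (complex.Re w, complex.Im w).
have [N Nl] := continuous_support_bounded continuous_lap lap0.
have M10 : 0 < M + 1 by rewrite addr_gt0.
have mB := measurable_box (M + 1).
have ml := continuous_measurable_plane continuous_lap.
have mL := measurable_ln_modulus w.
have cs : continuous (fun z : R * R => modulus (toC z - w) ^+ 2).
  have c1 : continuous (fun t : R * R => (t.1 - complex.Re w) ^+ 2).
    by apply: continuous_sqr => t; apply: cvgB; [exact: cvg_fst|exact: cvg_cst].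
  have c2 : continuous (fun t : R * R => (t.2 - complex.Im w) ^+ 2).
    by apply: continuous_sqr => t; apply: cvgB; [exact: cvg_snd|exact: cvg_cst].
  rewrite (_ : (fun z : R * R => _) = (fun t : R * R => (t.1 - complex.Re w) ^+ 2) \+
     (fun t => (t.2 - complex.Im w) ^+ 2)); last by apply/funext => t; exact: modulusE.
  by move=> z; exact: (cvgD (c1 z) (c2 z)).
(* The majorant of [half_ln_le] times |lap| is split in two: [G1] carries the singular ln^2, cut off
   to a box outside which [lap] vanishes, and [G2] is continuous with compact support. *)
pose G1 (z : plane R) : \bar R :=
  ((fun z => (ln (modulus (toC z - w)) ^+ 2)%:E) \_ (box (M + 1))) z.
pose G2 (z : R * R) := (2 + modulus (toC z - w) ^+ 2) * `|lap z|.
have iG1 : (@lebesgue2 R).-integrable setT G1.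
  by rewrite -integrable_mkcond//; exact: integrable_sqr_ln.
have cG2 : continuous G2.
  have cn : continuous (fun z => `|lap z|).
    move=> z; apply: (@continuous_comp _ _ _ lap (fun x : R => `|x|));
      [exact: continuous_lap|exact: norm_continuous].
  have cD : continuous (fun z : R * R => 2 + modulus (toC z - w) ^+ 2).
    by move=> z; apply: cvgD; [exact: cvg_cst|exact: cs].
  by move=> z; exact: (cvgM (cD z) (cn z)).
have iG2 : (@lebesgue2 R).-integrable setT (fun z => (G2 z)%:E).
  apply: (@continuous_box_integrable _ _ (M + 1) cG2) => z Mz.
  by rewrite /G2 lap0// normr0 mulr0.
have [] := @dominated_convergence _ _ _ (@lebesgue2 R) setT measurableT
  (fun n z => (2^-1 * ln (regq v (e n) z) * lap z)%:E)
  (fun z => (ln (modulus (toC z - w)) * lap z)%:E)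
  (fun z => N%:E * G1 z + (G2 z)%:E)%E.
- move=> n; apply/measurable_EFinP; apply: measurable_funM => //.
  apply: measurable_funM => //; apply: (measurableT_comp (@measurable_ln R)).
  exact: (continuous_measurable_plane (@continuous_regq R v (e n))).
- by apply/measurable_EFinP; exact: measurable_funM.
- apply: filterS (ae_neq_plane v) => z zv _.
  apply/fine_cvgP; split; first exact: nearW.
  exact: (cvgM (cvg_half_ln zv) (@cvg_cst _ (lap z) _ \oo _)).
- by apply: integrableD => //; exact: integrableZl.
- apply: filterS (ae_neq_plane v) => z zv n _.
  have [zB|zB] := boolP (z \in box (M + 1)); last first.
    have -> : lap z = 0.
      apply: lap0; move/negP : zB => zB.
      have [?|z1] := leP (M + 1) `|z.1|; [by left|].
      have [?|z2] := leP (M + 1) `|z.2|; [by right|].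
      exfalso; apply: zB; rewrite inE; split; rewrite /= in_itv/=.
      + by move: z1; rewrite ltr_norml => /andP[/ltW -> /ltW ->].
      + by move: z2; rewrite ltr_norml => /andP[/ltW -> /ltW ->].
    rewrite mulr0 abse0 /G1 patchE (negPf zB) mule0 add0e lee_fin.
    by rewrite mulr_ge0// addr_ge0// sqr_ge0.
  rewrite /G1 patchE zB -EFinM -EFinD lee_fin normrM.
  have := ler_wpM2r (normr_ge0 (lap z)) (half_ln_le n zv).
  move=> /le_trans; apply; rewrite mulrDl lerD2r mulrC.
  by rewrite ler_wpM2r// sqr_ge0.
move=> iL _ cvL; split => //.
have cvK := @cvg_kernel v.
rewrite -(cvg_lim _ cvL)// -(cvg_lim _ cvK)//; congr (limn _).
by apply/funext => n /=; exact: (log_green v C2f f0 M0 (e_gt0 n)).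
Qed.

End log_potential.

(** * The deterministic estimate *)

Lemma derive_open0 (R : realType) (O : set (R * R)) (f : R * R -> R) (v : R * R) :
  open O -> (forall z, O z -> f z = 0) -> forall z, O z -> 'D_v f z = 0.
Proof.
move=> oO f0 z Oz; apply: derive_near0.
have nO : nbhs z O by exact: open_nbhs_nbhs.
by apply: filterS nO => t Ot; rewrite f0.
Qed.

Section main_estimate.
Context (R : realType) (r : R) (f : R * R -> R).
Context (r1 : 1 <= r) (C2f : is_C2 f)
  (f0 : forall z : R * R, r <= modulus (toC z) -> f z = 0)
  (fr : forall z, `|'D_e1 ('D_e1 f) z + 'D_e2 ('D_e2 f) z| <= r).

Let lap z := 'D_e1 ('D_e1 f) z + 'D_e2 ('D_e2 f) z.

Let r0 : 0 < r. Proof. exact: lt_le_trans r1. Qed.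

Let continuous_lap : continuous lap.
Proof.
have [_ [_ _ c1 _] [_ _ _ c2]] := C2f.
by move=> z; exact: (cvgD (c1 z) (c2 z)).
Qed.

Let f0box (z : R * R) : r <= `|z.1| \/ r <= `|z.2| -> f z = 0.
Proof.
move=> h; apply: f0; case: h => h; first exact: le_trans (abs_fst_le_modulus z).
exact: le_trans (abs_snd_le_modulus z).
Qed.

Let continuous_modulus : continuous (fun z : R * R => modulus (toC z)).
Proof.
move=> z; apply: (@continuous_comp _ _ _ (fun z : R * R => z.1 ^+ 2 + z.2 ^+ 2) (@Num.sqrt R)).
  apply: cvgD; [apply: (@continuous_sqr R _ fst)|apply: (@continuous_sqr R _ snd)] => t;
    [exact: cvg_fst|exact: cvg_snd].
exact: sqrt_continuous.
Qed.

Let lap0_gt (z : R * R) : r < modulus (toC z) -> lap z = 0.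
Proof.
pose O := [set z : R * R | r < modulus (toC z)].
have oO : open O.
  rewrite (_ : O = (fun z => modulus (toC z)) @^-1` `]r, +oo[%classic).
    by move/continuousP: continuous_modulus; apply; exact: interval_open.
  by apply/seteqP; split => t /=; rewrite in_itv/= andbT.
have fO t : O t -> f t = 0 by move=> /ltW; exact: f0.
move=> rz; rewrite /lap.
by rewrite (derive_open0 e1 oO (derive_open0 e1 oO fO) rz)
  (derive_open0 e2 oO (derive_open0 e2 oO fO) rz) addr0.
Qed.

(** The hypothesis on [f] gives vanishing derivatives only in the open exterior |z| > r. The circle
    |z| = r is reached by continuity of [lap], along the points (1 + 1/(k+1)) z. *)
Let lap0 (z : R * R) : r <= modulus (toC z) -> lap z = 0.
Proof.
rewrite le_eqVlt => /predU1P[rz|]; last exact: lap0_gt.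
pose t (k : nat) : R * R := (z.1 + k.+1%:R^-1 * z.1, z.2 + k.+1%:R^-1 * z.2).
have ct : t k @[k --> \oo] --> z.
  have a (x y : R) : x + k.+1%:R^-1 * y @[k --> \oo] --> x.
    rewrite -[X in _ --> X]addr0; apply: cvgD; first exact: cvg_cst.
    rewrite -[X in _ --> X](mul0r y); apply: cvgM; last exact: cvg_cst.
    exact: (@cvg_harmonic R).
  have H (p : R * R) : p = (z.1, z.2) -> t k @[k --> \oo] --> p.
    by move=> ->; have H := cvg_pair (a z.1 z.1) (a z.2 z.2); exact: H.
  exact: H (surjective_pairing z).
have := cvg_comp t lap ct (@continuous_lap z).
rewrite (_ : lap \o t = fun=> 0); last first.
  apply/funext => k; apply: lap0_gt.
  have E : modulus (toC (t k)) = (1 + k.+1%:R^-1) * modulus (toC z).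
    rewrite /modulus/=; have k0 : 0 <= 1 + k.+1%:R^-1 :> R by rewrite addr_ge0// invr_ge0.
    rewrite -(ger0_norm k0) -sqrtr_sqr -sqrtrM ?sqr_ge0//.
    by congr Num.sqrt; ring.
  by rewrite E -rz ltr_pMl// ltrDl invr_gt0.
by move=> h; rewrite -(cvg_lim (@Rhausdorff R) h) lim_cst.
Qed.

Lemma integrable_lap : (@lebesgue2 R).-integrable setT (fun z => (lap z)%:E).
Proof.
apply: (continuous_box_integrable (M := r) continuous_lap) => z h.
by apply: lap0; case: h => h; [exact: le_trans (abs_fst_le_modulus z)|exact: le_trans (abs_snd_le_modulus z)].
Qed.

Let log_potential_sum (s : seq R[i]) :
  (@lebesgue2 R).-integrable setT
    (fun z => ((\sum_(u <- s) ln (modulus (toC z - u))) * lap z)%:E) /\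
  (\int[@lebesgue2 R]_z ((\sum_(u <- s) ln (modulus (toC z - u))) * lap z)%:E =
   (c0 R * \sum_(u <- s) f (complex.Re u, complex.Im u))%:E)%E.
Proof.
elim: s => [|u s [IH1 IH2]].
  have E : (fun z : plane R => ((\sum_(u <- [::]) ln (modulus (toC z - u))) * lap z)%:E) =
           cst 0%E.
    by apply/funext => z; rewrite big_nil mul0r.
  by rewrite E big_nil mulr0; split; [exact: integrable0|rewrite integral0].
have [iu Iu] := log_potential C2f r0 f0box u.
have E : (fun z : plane R => ((\sum_(v <- u :: s) ln (modulus (toC z - v))) * lap z)%:E) =
    (fun z => (ln (modulus (toC z - u)) * lap z)%:E +
              ((\sum_(v <- s) ln (modulus (toC z - v))) * lap z)%:E)%E.
  by apply/funext => z; rewrite big_cons mulrDl EFinD.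
rewrite E; split; first exact: integrableD.
by rewrite integralD// Iu IH2 big_cons -EFinD -mulrDr.
Qed.

Let modulus_sum_le (I : Type) (s : seq I) (F : I -> R[i]) :
  modulus (\sum_(i <- s) F i) <= \sum_(i <- s) modulus (F i).
Proof.
elim: s => [|i s IH]; first by rewrite !big_nil /modulus Normc.normc0.
by rewrite !big_cons; apply: (le_trans (le_normcD _ _)); rewrite lerD2l.
Qed.

(** Replaces the disk of radius [d] around [a], which it contains; being a product of intervals, it
    has an immediate measure. *)
Definition square (d : R) (a : R[i]) : set (plane R) :=
  ball (complex.Re a) d `*` ball (complex.Im a) d.

Lemma measurable_square d a : measurable (square d a).
Proof. by apply: measurableX; exact: measurable_ball. Qed.

Lemma square_measure d a : 0 < d -> lebesgue2 R (square d a) = (4 * d ^+ 2)%:E.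
Proof.
move=> d0; rewrite [lebesgue2 R _]product_measure1E; [|exact: measurable_ball..].
rewrite [X in (X * _)%E](lebesgue_measure_ball _ (ltW d0)).
rewrite [X in (_ * X)%E](lebesgue_measure_ball _ (ltW d0)).
by rewrite -EFinM; congr EFin; rewrite -mulr_natl; ring.
Qed.

Section estimate.
(** Here [N] is the set where |S| may be small, [m] bounds its measure and [beta] bounds |S| from
    below elsewhere in the disk. Squares of half-side [delta] isolate the [x i], [Lam] is the
    resulting bound for |ln |S| - ln n|, and [Tr] is a free parameter, later a power of n. *)
Context (n : nat) (x : 'I_n -> R[i]) (N : set (plane R)) (m beta delta Lam Tr : R).
Context (n0 : (0 < n)%N) (xr : forall i, modulus (x i) <= expR r)
  (mN : measurable N) (Nm : (lebesgue2 R N <= m%:E)%E)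
  (hN : forall z, modulus (toC z) < r -> ~ N z ->
     beta <= modulus (\sum_(i < n) (toC z - x i)^-1))
  (b0 : 0 < beta) (d0 : 0 < delta) (L0 : 0 <= Lam) (T0 : 0 < Tr)
  (Lb : ln n%:R - ln beta <= Lam) (Ld : - ln delta <= Lam).

Let cp := critical_points (\prod_(i < n) ('X - (x i)%:P)).
Let xs := [seq x i | i <- enum 'I_n].

Let Phi (z : R * R) : R := \sum_(w <- cp) ln (modulus (toC z - w)) -
  \sum_(w <- xs) ln (modulus (toC z - w)).

(** On the good set beta <= |S(z)| <= n/delta, because each |z - x_i| is at least [delta]. Hence ln
    |S| - ln n lies between ln beta - ln n and - ln delta. *)
Let Phi_good z : modulus (toC z) < r -> ~ N z -> (forall i, ~ square delta (x i) z) ->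
  `|Phi z| <= Lam.
Proof.
move=> zr Nz sz.
have dx i : delta <= modulus (toC z - x i).
  rewrite leNgt; apply/negP => zd; apply: (sz i); split; rewrite /ball/=.
  - rewrite distrC; apply: le_lt_trans zd; case: z {zr Nz sz} => a b; case: (x i) => c d.
    exact: (abs_fst_le_modulus (a - c, b - d)).
  - rewrite distrC; apply: le_lt_trans zd; case: z {zr Nz sz} => a b; case: (x i) => c d.
    exact: (abs_snd_le_modulus (a - c, b - d)).
have zx i : toC z != x i.
  by rewrite -subr_eq0 -modulus_gt0 (lt_le_trans d0).
have Sb := hN zr Nz; set S := \sum_(i < n) _ in Sb.
have S0 : 0 < modulus S by exact: lt_le_trans Sb.
have Sd : modulus S <= n%:R * delta^-1.
  apply: (le_trans (modulus_sum_le _ _)).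
  apply: (@le_trans _ _ (\sum_(i < n) delta^-1)); last first.
    by rewrite sumr_const card_ord mulr_natl.
  apply: ler_sum => i _; rewrite /modulus Normc.normcV lef_pV2 ?posrE//; first exact: dx.
  exact: lt_le_trans d0 (dx i).
have nR0 : 0 < n%:R :> R by rewrite ltr0n.
have -> : Phi z = ln (modulus S) - ln n%:R.
  rewrite -(log_derivative n0 zx); last by rewrite -modulus_gt0.
  by rewrite /Phi /xs big_map big_enum.
have l1 : ln beta <= ln (modulus S) by rewrite ler_ln.
have l2 : ln (modulus S) <= ln n%:R - ln delta.
  rewrite -lnV ?posrE// -lnM ?posrE ?invr_gt0// ler_ln ?posrE//.
  by rewrite mulr_gt0// invr_gt0.
rewrite ler_norml; move: l1 l2 Lb Ld.
move: (ln (modulus S)) (ln beta) (ln n%:R) (ln delta) => s1 s2 s3 s4 *.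
by apply/andP; split; lra.
Qed.

Let us := cp ++ xs.

Let us_bound u : u \in us -> modulus u <= expR r.
Proof.
rewrite mem_cat => /orP[ucp|/mapP[i _ ->//]].
exact: (critical_points_bounded n0 xr ucp).
Qed.

Let size_us : (size us)%:R <= 2 * n%:R :> R.
Proof.
rewrite size_cat size_critical_points// size_map size_enum_ord -natrM ler_nat mul2n -addnn leq_add2r.
exact: leq_pred.
Qed.

Let ind (A : set (plane R)) : plane R -> R := \1_A.

(* At least 1 off the good set. *)
Let kap (z : plane R) : R := ind N z + \sum_(i < n) ind (square delta (x i)) z.

Let ind_ge0 A z : 0 <= ind A z. Proof. by rewrite /ind indicE. Qed.

Let kap_ge0 z : 0 <= kap z.
Proof. by rewrite addr_ge0// sumr_ge0. Qed.

Let sl (u : R[i]) (z : plane R) : R := ln (modulus (toC z - u)) ^+ 2 * ind (box r) z.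

(** The first term pays for the good points. At an exceptional point of the disk [kap] is at least
    1, [r] bounds |lap|, and each |ln| is split into a part proportional to [kap] and a part
    proportional to its square. The integral then only needs the measure of the exceptional set and
    the L^2 norms. *)
Let dom (z : plane R) : R := Lam * `|lap z| +
  r * \sum_(u <- us) (2^-1 * Tr * kap z + (2 * Tr)^-1 * sl u z).

Let sl_ge0 u z : 0 <= sl u z. Proof. by rewrite mulr_ge0// sqr_ge0. Qed.

Let term_ge0 u z : 0 <= 2^-1 * Tr * kap z + (2 * Tr)^-1 * sl u z.
Proof. by rewrite addr_ge0// mulr_ge0// ?invr_ge0 ?mulr_ge0 ?(ltW T0). Qed.

Let Phi_le_dom z : `|Phi z * lap z| <= dom z.
Proof.
rewrite /dom normrM.
have s0 : 0 <= r * \sum_(u <- us) (2^-1 * Tr * kap z + (2 * Tr)^-1 * sl u z).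
  by rewrite mulr_ge0 ?(ltW r0)// sumr_ge0.
have [rz|zr] := leP r (modulus (toC z)).
  by rewrite lap0// normr0 !mulr0 add0r.
have [k1|k1] := leP 1 (kap z); last first.
  apply: (@le_trans _ _ (Lam * `|lap z|)); last by rewrite lerDl.
  rewrite ler_wpM2r// Phi_good//.
  - move=> Nz; move: k1; apply/negP; rewrite -leNgt /kap {1}/ind indicE mem_set// lerDl.
    exact: sumr_ge0.
  - move=> i sz; move: k1; apply/negP; rewrite -leNgt /kap (bigD1 i)//= {2}/ind indicE mem_set//.
    by rewrite addrCA lerDl addr_ge0// sumr_ge0.
apply: (@le_trans _ _ (r * \sum_(u <- us) (2^-1 * Tr * kap z + (2 * Tr)^-1 * sl u z))); last first.
  by rewrite lerDr mulr_ge0.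
rewrite mulrC; apply: ler_pM => //; first exact: fr.
apply: (@le_trans _ _ (\sum_(u <- us) `|ln (modulus (toC z - u))|)).
  rewrite /us big_cat /Phi; apply: (le_trans (ler_normB _ _)).
  by apply: lerD; exact: ler_norm_sum.
apply: ler_sum => u _.
have zB : box r z.
  split; rewrite /= in_itv/= -ler_norml ltW//.
  - exact: le_lt_trans (abs_fst_le_modulus z) zr.
  - exact: le_lt_trans (abs_snd_le_modulus z) zr.
rewrite /sl {1}/ind indicE mem_set// mulr1.
set l := ln _.
apply: (@le_trans _ _ (2^-1 * Tr + (2 * Tr)^-1 * l ^+ 2)); last first.
  by rewrite lerD2r ler_peMr// mulr_ge0 ?invr_ge0// ltW.
(* AM-GM: [2 T |l| <= T^2 + l^2] *)
rewrite -subr_ge0 (_ : _ - _ = (2 * Tr)^-1 * (Tr - `|l|) ^+ 2).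
  by rewrite mulr_ge0 ?sqr_ge0// invr_ge0 mulr_ge0// ltW.
by rewrite -(real_normK (num_real l)); field; rewrite gt_eqF.
Qed.

(** Taking [L] equal to [3 * r] in [integral_sqr_ln] gives 36 r^4 + 256 r, and r <= r^4 because r >=
    1; 292 = 36 + 256. *)
Let Q : R := 292 * r ^+ 4.

Let sl_int u : u \in us -> (\int[lebesgue2 R]_z (sl u z)%:E <= Q%:E)%E.
Proof.
move=> uus.
have -> : (\int[lebesgue2 R]_z (sl u z)%:E =
    \int[lebesgue2 R]_(z in box r) (ln (modulus (toC z - u)) ^+ 2)%:E)%E.
  rewrite [RHS]integral_mkcond; apply: eq_integral => z _.
  by rewrite patchE /sl /ind indicE; case: ifP => _; rewrite ?mulr1 ?mulr0.
(* The exponent 3r works because |z - u| <= 2r + exp r <= exp (3r) on the box. *)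
have r3 : 0 <= 3 * r by rewrite mulr_ge0// ltW.
apply: le_trans (integral_sqr_ln r0 r3 _) _.
  move=> z Bz; apply: (le_trans (modulusB_le u Bz)).
  have h1 := us_bound uus.
  have h2 : 1 + r <= expR r := expR_ge1Dx r.
  have h3 : 1 + 2 * r <= expR (2 * r) := expR_ge1Dx (2 * r).
  rewrite (_ : 3 * r = r + 2 * r); last by ring.
  by rewrite expRD; nra.
rewrite lee_fin /Q.
have h4 : r <= r ^+ 4 by rewrite ler_eXnr.
by rewrite (_ : 4 * r ^+ 2 * (3 * r) ^+ 2 = 36 * r ^+ 4); [lra|ring].
Qed.

Let kap_int : (\int[lebesgue2 R]_z (kap z)%:E <= (m + n%:R * (4 * delta ^+ 2))%:E)%E.
Proof.
under eq_integral do rewrite /kap EFinD -sumEFin.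
have mi A : measurable A -> measurable_fun [set: plane R] (fun z => (ind A z)%:E).
  by move=> mA; apply/measurable_EFinP; exact: measurable_indic.
have msq i := measurable_square delta (x i).
rewrite ge0_integralD//; last 4 first.
- by move=> z _; rewrite lee_fin.
- exact: mi.
- by move=> z _; apply: sume_ge0 => i _; rewrite lee_fin.
- by apply: emeasurable_sum => i; exact: mi.
rewrite EFinD; apply: leeD; first by rewrite integral_indic// setIT.
rewrite ge0_integral_sum//; last 2 first.
- by move=> i; exact: mi.
- by move=> i z _; rewrite lee_fin.
rewrite (_ : (n%:R * (4 * delta ^+ 2))%:E = \sum_(i < n) (4 * delta ^+ 2)%:E)%E; last first.
  by rewrite sumEFin sumr_const card_ord mulr_natl.
by apply: lee_sum => i _; rewrite integral_indic// setIT square_measure.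
Qed.

(** By the potential formula the left side is |int Phi lap|, and the right side bounds the integral
    of [dom]: there are at most [2 * n%:R] logarithms, critical points and zeros together, and each
    costs the same. *)
Lemma critical_points_estimate (L : R) :
  (\int[lebesgue2 R]_z (`|lap z|)%:E = L%:E)%E ->
  c0 R * `|\sum_(w <- cp) f (complex.Re w, complex.Im w) -
           \sum_(i < n) f (complex.Re (x i), complex.Im (x i))| <=
  Lam * L + r * (2 * n%:R * (2^-1 * Tr * (m + n%:R * (4 * delta ^+ 2)) +
                             (2 * Tr)^-1 * (292 * r ^+ 4))).
Proof.
move=> LE.
have [icp Icp] := log_potential_sum cp; have [ixs Ixs] := log_potential_sum xs.
have PhiE : (\int[lebesgue2 R]_z (Phi z * lap z)%:E =
   (c0 R * (\sum_(w <- cp) f (complex.Re w, complex.Im w) -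
           \sum_(i < n) f (complex.Re (x i), complex.Im (x i))))%:E)%E.
  rewrite mulrBr EFinB -Icp.
  rewrite (_ : \sum_(i < n) _ = \sum_(w <- xs) f (complex.Re w, complex.Im w)); last first.
    by rewrite /xs big_map big_enum.
  rewrite -Ixs -integralB//; apply: eq_integral => z _.
  by rewrite -EFinB -mulrBl.
have iPhi : (lebesgue2 R).-integrable setT (fun z => (Phi z * lap z)%:E).
  rewrite (_ : (fun z => _) = (fun z : plane R =>
     (((\sum_(u <- cp) ln (modulus (toC z - u))) * lap z)%:E -
     ((\sum_(u <- xs) ln (modulus (toC z - u))) * lap z)%:E)%E)); first exact: integrableB.
  by apply/funext => z; rewrite -EFinB -mulrBl.
have ml := continuous_measurable_plane continuous_lap.
have mal : measurable_fun [set: plane R] (fun z => `|lap z|).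
  exact: measurableT_comp.
have mi A : measurable A -> measurable_fun [set: plane R] (ind A).
  by move=> mA; exact: measurable_indic.
have mkap : measurable_fun [set: plane R] kap.
  apply: measurable_funD; first exact: mi.
  by apply: measurable_sum => i; apply: mi; exact: measurable_square.
have msl u : measurable_fun [set: plane R] (sl u).
  apply: measurable_funM; last by apply: mi; exact: measurable_box.
  by apply: measurable_funX; exact: measurable_ln_modulus.
have mkape : measurable_fun [set: plane R] (fun z => (kap z)%:E) by exact/measurable_EFinP.
have msle u : measurable_fun [set: plane R] (fun z => (sl u z)%:E) by exact/measurable_EFinP.
have mterm u : measurable_fun [set: plane R]
    (fun z => 2^-1 * Tr * kap z + (2 * Tr)^-1 * sl u z).
  by apply: measurable_funD; apply: measurable_funM.
have -> : c0 R * `|\sum_(w <- cp) f (complex.Re w, complex.Im w) -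
    \sum_(i < n) f (complex.Re (x i), complex.Im (x i))| =
    `|c0 R * (\sum_(w <- cp) f (complex.Re w, complex.Im w) -
    \sum_(i < n) f (complex.Re (x i), complex.Im (x i)))|.
  by rewrite normrM gtr0_norm// c0_gt0.
have T20 : 0 <= (2 * Tr)^-1 by rewrite invr_ge0 mulr_ge0// ltW.
have T20' : 0 <= 2^-1 * Tr by rewrite mulr_ge0 ?invr_ge0// ltW.
set B := 2^-1 * Tr * (m + _) + _.
have termB u : u \in us ->
    (\int[lebesgue2 R]_z (2^-1 * Tr * kap z + (2 * Tr)^-1 * sl u z)%:E <= B%:E)%E.
  move=> uus.
  rewrite (_ : (\int[_]_z _)%E = (\int[lebesgue2 R]_z
      ((2^-1 * Tr)%:E * (kap z)%:E + ((2 * Tr)^-1)%:E * (sl u z)%:E))%E); last first.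
    by apply: eq_integral => z _; rewrite -!EFinM -EFinD.
  rewrite ge0_integralD//; last 4 first.
  - by move=> z _; rewrite -EFinM lee_fin mulr_ge0.
  - exact: measurable_funeM.
  - by move=> z _; rewrite -EFinM lee_fin mulr_ge0.
  - exact: measurable_funeM.
  rewrite !ge0_integralZl//; last 2 first.
  - by move=> z _; rewrite lee_fin.
  - by move=> z _; rewrite lee_fin.
  rewrite /B EFinD (EFinM (2^-1 * Tr)) (EFinM (2 * Tr)^-1).
  by apply: leeD; apply: lee_wpmul2l; rewrite ?lee_fin//; exact: sl_int.
have m0 : 0 <= m by rewrite -lee_fin; exact: le_trans (measure_ge0 _ _) Nm.
have B0 : 0 <= B.
  have d4 : 0 <= n%:R * (4 * delta ^+ 2) by rewrite mulr_ge0// mulr_ge0// sqr_ge0.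
  have r4 : 0 <= 292 * r ^+ 4.
    by apply: mulr_ge0; [exact: ler0n|rewrite exprn_ge0// ltW].
  by apply: addr_ge0; apply: mulr_ge0 => //; exact: addr_ge0.
have mterme u : measurable_fun [set: plane R]
    (fun z => (2^-1 * Tr * kap z + (2 * Tr)^-1 * sl u z)%:E).
  exact/measurable_EFinP.
have msum : measurable_fun [set: plane R]
    (fun z => (\sum_(u <- us) (2^-1 * Tr * kap z + (2 * Tr)^-1 * sl u z))%:E).
  under eq_fun do rewrite -sumEFin.
  exact: emeasurable_sum.
have male : measurable_fun [set: plane R] (fun z => (`|lap z|)%:E).
  exact/measurable_EFinP.
rewrite -lee_fin -abse_EFin -PhiE.
apply: (le_trans (le_abse_integral _ measurableT (measurable_int _ iPhi))).
apply: (@le_trans _ _ (\int[lebesgue2 R]_z (Lam%:E * (`|lap z|)%:E +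
    r%:E * (\sum_(u <- us) (2^-1 * Tr * kap z + (2 * Tr)^-1 * sl u z))%:E))%E).
  apply: ge0_le_integral => //.
  - by apply: measurableT_comp => //; exact: measurable_int iPhi.
  - by apply: emeasurable_funD; apply: measurable_funeM.
  - by move=> z _; rewrite abse_EFin -!EFinM -EFinD lee_fin; exact: Phi_le_dom.
have sum_ge0 z : 0 <= \sum_(u <- us) (2^-1 * Tr * kap z + (2 * Tr)^-1 * sl u z).
  exact: sumr_ge0.
have r0' : 0 <= r by exact: ltW.
rewrite ge0_integralD//; last 4 first.
- by move=> z _; rewrite -EFinM lee_fin mulr_ge0.
- exact: measurable_funeM.
- by move=> z _; rewrite -EFinM lee_fin mulr_ge0.
- exact: measurable_funeM.
rewrite !ge0_integralZl//; last by move=> z _; rewrite lee_fin.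
rewrite LE EFinD -EFinM leeD2l// EFinM lee_wpmul2l// ?lee_fin//.
under eq_integral do rewrite -sumEFin.
rewrite ge0_integral_sum//; last by move=> u z _; rewrite lee_fin.
apply: (@le_trans _ _ (\sum_(u <- us) B%:E)%E).
  by rewrite !big_seq; apply: lee_sum.
by rewrite sumEFin lee_fin big_const_seq count_predT iter_addr_0 -(mulr_natl B) ler_wpM2r.
Qed.

End estimate.
End main_estimate.

(** * Probabilistic part *)

(** The crude bound |z| <= |z.1| + |z.2| <= 2r/3 suffices: the box only serves to show that the disk
    has positive measure. *)
Lemma box_sub_disk (R : realType) (r : R) : 0 < r -> box (r / 3) `<=` disk r.
Proof.
move=> r0 z [/=]; rewrite !in_itv/= -!ler_norml => z1 z2.
by apply: (le_lt_trans (modulus_toC_le z)); lra.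
Qed.

Lemma disk_sub_box (R : realType) (r : R) : disk r `<=` box r.
Proof.
move=> z; rewrite /disk /= => zr; split; rewrite /= in_itv/= -ler_norml.
- exact: le_trans (abs_fst_le_modulus z) (ltW zr).
- exact: le_trans (abs_snd_le_modulus z) (ltW zr).
Qed.

Lemma mnormalizeE (R : realType) (d : measure_display) (T : measurableType d)
    (mu : {measure set T -> \bar R}) (P : probability T R) (V : set T) :
  (0 < mu setT)%E -> (mu setT < +oo)%E ->
  mnormalize mu P V = (mu V * (fine (mu setT))^-1%:E)%E.
Proof. by move=> h1 h2; rewrite /mnormalize gt_eqF// lt_eqF. Qed.

(** Undoes the normalization: the Lebesgue measure is the uniform probability times the area of the
    disk, which is at most that of the enclosing box, [4 * r ^+ 2]. *)
Lemma uniform_disk_le (R : realType) (r eta : R) (B : set (plane R)) :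
  0 < r -> 0 <= eta -> measurable B -> (uniform_disk r B <= eta%:E)%E ->
  (lebesgue2 R (B `&` disk r) <= (4 * r ^+ 2 * eta)%:E)%E.
Proof.
move=> r0 eta0 mB; have r30 : 0 < r / 3 by rewrite divr_gt0.
have mD := measurable_disk r.
have D1 : (lebesgue2 R (disk r) <= (4 * r ^+ 2)%:E)%E.
  rewrite -box_measure//; apply: le_measure; rewrite ?inE//; first exact: measurable_box.
  exact: disk_sub_box.
have D2 : (0 < lebesgue2 R (disk r))%E.
  apply: (@lt_le_trans _ _ (lebesgue2 R (box (r / 3)))).
    by rewrite box_measure// lte_fin mulr_gt0// exprn_gt0.
  by apply: le_measure; rewrite ?inE//; [exact: measurable_box|exact: box_sub_disk].
have Dfin : lebesgue2 R (disk r) \is a fin_num.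
  by rewrite ge0_fin_numE// (le_lt_trans D1)// ltry.
have -> : uniform_disk r B =
    mnormalize (mrestr (@lebesgue2 R) mD) (\d_ ((0, 0) : plane R)) B by [].
have D3 : (lebesgue2 R (disk r) < +oo)%E by exact: le_lt_trans D1 (ltry _).
rewrite mnormalizeE /= /mrestr ?setTI//.
rewrite -(fineK Dfin) lee_fin in D1; rewrite -(fineK Dfin) lte_fin in D2.
rewrite lee_pdivrMr// => /le_trans; apply.
by rewrite -EFinM lee_fin mulrC ler_wpM2r.
Qed.

(** By Fubini, the probability that U gives to the section of the complement of [A] has P-mean at
    most [eps], so by Markov it exceeds [eta] with probability at most [eps / eta]. This turns a
    statement on the pair (w, z) into one on the set of bad z for a fixed sample w. *)
Lemma section_markov (R : realType) (d : measure_display) (T : measurableType d)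
    (P : probability T R) (U : probability (plane R) R) (A : set (T * plane R))
    (eps eta : R) : measurable A -> 0 < eta ->
  ((1 - eps)%:E <= (P \x U)%E A)%E ->
  exists H : set T, [/\ measurable H, ((1 - eps / eta)%:E <= P H)%E &
    forall w, H w -> (U (xsection (~` A) w) <= eta%:E)%E].
Proof.
move=> mA eta0 hA.
have mAc : measurable (~` A) by exact: measurableC.
pose h w := U (xsection (~` A) w).
have mh : measurable_fun setT h by exact: measurable_fun_xsection.
pose H := [set w | (h w <= eta%:E)%E].
have mH : measurable H.
  by rewrite -[H]setTI; exact: emeasurable_fun_infty_c.
have hAc : ((P \x U)%E (~` A) <= eps%:E)%E.
  by rewrite probability_setC// leeBlDr ?fin_num_measure// addeC -leeBlDr.
have hHc : (eta%:E * P (~` H) <= eps%:E)%E.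
  apply: le_trans hAc; rewrite [leRHS]/product_measure1.
  apply: (@le_trans _ _ (\int[P]_(w in ~` H) h w)%E).
    rewrite -integral_cst; last exact: measurableC.
    apply: ge0_le_integral => //.
    - exact: measurableC.
    - by move=> w _; rewrite lee_fin ltW.
    - exact: measurable_funTS.
    - by move=> w /= /negP; rewrite -ltNge => /ltW.
  by apply: ge0_subset_integral => //; exact: measurableC.
exists H; split => //.
have PHc : (P (~` H) <= (eps / eta)%:E)%E.
  by rewrite EFinM lee_pdivlMr// muleC.
rewrite -[H]setCK probability_setC; last exact: measurableC.
by rewrite EFinB; apply: leeB.
Qed.

Lemma prob_ge_setI (R : realType) (d : measure_display) (T : measurableType d)
    (P : probability T R) (A B : set T) (a b : R) : measurable A -> measurable B ->
  ((1 - a)%:E <= P A)%E -> ((1 - b)%:E <= P B)%E ->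
  ((1 - (a + b))%:E <= P (A `&` B))%E.
Proof.
move=> mA mB hA hB.
have mAc := measurableC mA; have mBc := measurableC mB.
have cA : (P (~` A) <= a%:E)%E.
  by rewrite probability_setC// leeBlDr ?fin_num_measure// addeC -leeBlDr.
have cB : (P (~` B) <= b%:E)%E.
  by rewrite probability_setC// leeBlDr ?fin_num_measure// addeC -leeBlDr.
rewrite -[A `&` B]setCK probability_setC; last by apply: measurableC; exact: measurableI.
rewrite EFinB; apply: leeB => //; rewrite setCI EFinD.
by apply: (le_trans (measureU2 _ mAc mBc)); exact: leeD.
Qed.

(** The exponents solve three equations that make each error term exactly a multiple of y^(-c): [t]
    is dictated by the L^2 term, then [a] by the small values of S and [d] by the squares. The
    coefficients are 4 + 4 + 292 = 300. *)
Lemma powR_error (R : realType) (C c t a d y : R) : 1 < y ->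
  t = 5 * C + 1 + c -> a = 2 * (3 * C + 1 + t + c) -> d = (C + 2 + t + c) / 2 ->
  y `^ C * (2 * y * (2^-1 * y `^ t * (4 * (y `^ C) ^+ 2 * y `^ (- (a / 2)) +
     y * (4 * (y `^ (- d)) ^+ 2)) + (2 * y `^ t)^-1 * (292 * (y `^ C) ^+ 4))) =
  300 * y `^ (- c).
Proof.
move=> y1 tE aE dE; have y0 : 0 < y by lra.
have yN : y != 0 by rewrite gt_eqF.
have P (p q : R) : y `^ (p + q) = y `^ p * y `^ q by rewrite powRD// yN implybT.
have X (p : R) (k : nat) : (y `^ p) ^+ k = y `^ (p * k%:R).
  by rewrite -powR_mulrn ?powR_ge0// -powRrM.
have tV : (2 * y `^ t)^-1 = 2^-1 * y `^ (- t) by rewrite invfM powRN.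
transitivity (4 * (y `^ C * y `^ 1 * y `^ t * y `^ (C * 2%:R) * y `^ (- (a / 2))) +
   4 * (y `^ C * y `^ 1 * y `^ t * y `^ 1 * y `^ (- d * 2%:R)) +
   292 * (y `^ C * y `^ 1 * y `^ (- t) * y `^ (C * 4%:R))).
  by rewrite tV !X powRr1 ?(ltW y0)//; field.
rewrite -!P.
have -> : C + 1 + t + C * 2 - a / 2 = - c by rewrite aE; field.
have -> : C + 1 + t + 1 + - d * 2 = - c by rewrite dE; field.
have -> : C + 1 - t + C * 4 = - c by rewrite tE; ring.
ring.
Qed.

Theorem theorem2p14 (R : realType) (C : R) (hC : 0 < C)
    (K1 : R -> R) (hK1 : forall alpha, 0 < alpha -> 0 < K1 alpha)
    (b : R -> R) (hb : forall a, 0 < a -> 0 < b a)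
    (K2 : R -> R) (hK2 : forall a, 0 < a -> 0 < K2 a)
    (c : R) (hc : 0 < c) (alpha : R) (halpha : 0 < alpha) :
  exists K : R, 0 < K /\
    forall (d : nat -> measure_display) (T : forall n, measurableType (d n))
      (P : forall n, probability (T n) R)
      (X : forall n, 'I_n -> T n -> R[i]),
    (forall n i, complex_rv (X n i)) ->
    upper_bound P X C K1 ->
    anti_concentration P X C b K2 ->
    forall phi : nat -> R[i] -> R,
    (forall n, admissible_test C n (phi n)) ->
    forall n : nat, K < n%:R ->
    prob_ge (P n)
      [set w | `| \sum_(wj <- critical_points
                          (\prod_(i < n) ('X - (X n i w)%:P))) phi n wj
                  - \sum_(i < n) phi n (X n i w) |
               <= K * (L1norm_laplacian (phi n) * ln n%:R)
                  + K * n%:R `^ (- c)]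
      (1 - K * n%:R `^ (- alpha)).
Proof.
(* Aiming at the error n^(-(c + alpha)) makes a/2 exceed both c and alpha, so a single [a] serves
   the error term and the probability. *)
pose c' := c + alpha; pose t := 5 * C + 1 + c'.
pose a := 2 * (3 * C + 1 + t + c'); pose d := (C + 2 + t + c') / 2.
(* For beta = n^(-b a) and delta = n^(-d), the two logarithmic bounds are (1 + b a) ln n and d ln n;
   their sum covers both. *)
pose Lam := 1 + b a + d.
have a0 : 0 < a by rewrite /a /t /c'; lra.
have d0 : 0 < d by rewrite /d /t /c'; lra.
have ba0 := hb _ a0; have K10 := hK1 _ halpha; have K20 := hK2 _ a0.
have Lam0 : 0 < Lam by rewrite /Lam; lra.
have cV0 : 0 < (c0 R)^-1 by rewrite invr_gt0 c0_gt0.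
have h300 : 0 < 300 :> R by rewrite ltr0n.
have M0 : 0 < (c0 R)^-1 * (Lam + 300) := mulr_gt0 cV0 (addr_gt0 Lam0 h300).
(* The first summand covers the two error terms, the next two the loss of probability and the
   thresholds of the hypotheses, and the final 1 forces n > 1, hence ln n > 0. Nothing here depends
   on the probability spaces or on [phi]. *)
pose K := (c0 R)^-1 * (Lam + 300) + K1 alpha + K2 a + 1.
have [[KLam K300] [KK K1K K2K]] : ((c0 R)^-1 * Lam <= K /\ (c0 R)^-1 * 300 <= K) /\
    [/\ 1 + K1 alpha + K2 a < K, K1 alpha < K & K2 a < K].
  have := mulr_gt0 cV0 Lam0; have := mulr_gt0 cV0 h300; move: K10 K20 M0.
  rewrite /K mulrDr; clear.
  move: (_ * Lam) (_ * 300) (K1 alpha) (K2 a) => k1 k2 k3 k4 *.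
  by split; split; lra.
exists K; split; first exact: lt_trans K1K.
move=> ds T P X hX hub hac phi hphi n Kn.
set y : R := n%:R in Kn *.
have y1 : 1 < y by apply: lt_trans Kn; clear - KK K10 K20; lra.
have y0 : 0 < y by lra.
have n0 : (0 < n)%N by rewrite -(ltr0n R).
pose r := y `^ C.
have r1 : 1 <= r by rewrite -(powRr0 y) ler_powR// ltW.
have r0 : 0 < r by lra.
have ly0 : 0 < ln y by exact: ln_gt0.
have [A1 [mA1 sA1 pA1]] := hub alpha halpha n (lt_trans K1K Kn).
have [A2 [mA2 sA2 pA2]] := hac a a0 n (lt_trans K2K Kn).
(* The square root of n^(-a) balances Markov's inequality: the bad sections have probability at most
   [eta], outside an event of probability at most [K2 a * eta]. *)
pose eta := y `^ (- (a / 2)).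
have eta0 : 0 < eta by rewrite powR_gt0.
have [H [mH pH sH]] := section_markov mA2 eta0 pA2.
have epsE : K2 a * y `^ (- a) / eta = K2 a * eta.
  have -> : y `^ (- a) = eta * eta.
    rewrite /eta -powRD; last by rewrite (gt_eqF y0) implybT.
    by congr (_ `^ _); field.
  by field; rewrite gt_eqF.
rewrite -/y epsE in pH.
have [C2f f0 fr] := hphi n.
have ya0 : 0 < y `^ (- alpha) by rewrite powR_gt0.
(* This witness is measurable by construction, which avoids any question about the measurability of
   the critical points in the sample. *)
exists (A1 `&` H); split; first exact: measurableI; last first.
  apply: le_trans (prob_ge_setI mA1 mH pA1 pH).
  have etaa : eta <= y `^ (- alpha).
    by rewrite ler_powR ?(ltW y1)// lerN2 /a /t /c'; lra.
  rewrite lee_fin lerD2l lerN2 -/y.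
  apply: (@le_trans _ _ ((K1 alpha + K2 a) * y `^ (- alpha))).
    by rewrite mulrDl lerD2l ler_wpM2l// ltW.
  rewrite ler_wpM2r ?(ltW ya0)//; clear - KK; lra.
move=> w [A1w Hw] /=.
pose x i := X n i w.
have xr i : modulus (x i) <= expR r.
  by apply: le_trans (sA1 _ A1w); exact: (le_bigmax 0 (fun i => modulus (X n i w)) i).
(* The sample [w] is now fixed. Any z of the disk outside [N] has (w, z) in [A2], where the lower
   bound on |S| holds. *)
pose N : set (plane R) := xsection (~` A2) w `&` disk r.
have mS : measurable (xsection (~` A2) w).
  by apply: measurable_xsection; exact: measurableC.
have mN : measurable N by apply: measurableI => //; exact: measurable_disk.
have Nm := uniform_disk_le r0 (ltW eta0) mS (sH _ Hw).
have hN z : modulus (toC z) < r -> ~ N z ->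
    y `^ (- b a) <= modulus (\sum_(i < n) (toC z - x i)^-1).
  move=> zr Nz; suff /sA2 : A2 (w, z) by [].
  apply: contrapT => Az; apply: Nz; split => //.
  by rewrite /xsection /= inE.
pose f := phi n \o @toC R.
have f0' (z : R * R) : r <= modulus (toC z) -> f z = 0 by move=> rz; exact: f0.
have iL := integrable_lap r1 C2f f0'.
have iLa : (@lebesgue2 R).-integrable setT (fun z => (`|laplacian (phi n) z|)%:E).
  exact: integrable_norm iL.
have LE : (\int[@lebesgue2 R]_z (`|laplacian (phi n) z|)%:E =
    (L1norm_laplacian (phi n))%:E)%E.
  rewrite /L1norm_laplacian Lnorm1 fineK//.
  exact: integrable_fin_num iLa.
have L0 : 0 <= L1norm_laplacian (phi n).
  by rewrite -lee_fin -LE; apply: integral_ge0 => z _; rewrite lee_fin.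
have := critical_points_estimate r1 C2f f0' fr n0 xr mN Nm hN
  (powR_gt0 _ y0) (powR_gt0 (- d) y0) (mulr_ge0 (ltW Lam0) (ltW ly0)) (powR_gt0 t y0)
  _ _ LE.
have Ld : - ln (y `^ (- d)) <= Lam * ln y.
  by rewrite ln_powR mulNr opprK ler_wpM2r ?(ltW ly0)// /Lam; lra.
have Lb : ln n%:R - ln (y `^ (- b a)) <= Lam * ln y.
  rewrite ln_powR mulNr opprK -/y -{1}(mul1r (ln y)) -mulrDl ler_wpM2r ?(ltW ly0)//.
  by rewrite /Lam; lra.
(* With Tr = n^t, delta = n^(-d) and m = 4 r^2 eta, the remainder of the deterministic estimate is
   the left side of [powR_error]. *)
move=> /(_ Lb Ld); rewrite (@powR_error R C c' t a d y)//.
have phiE u : f (complex.Re u, complex.Im u) = phi n u by case: u.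
rewrite (eq_bigr (phi n) (fun u _ => phiE u)).
rewrite (eq_bigr (fun i => phi n (x i)) (fun i _ => phiE (x i))).
set D := `|_ - _|; set L := L1norm_laplacian _ => hD.
have cc : y `^ (- c') <= y `^ (- c).
  by rewrite ler_powR ?(ltW y1)// lerN2 /c'; lra.
have yc0 : 0 <= y `^ (- c) by exact: powR_ge0.
have Lly : 0 <= L * ln y by rewrite mulr_ge0// ltW.
have {hD} : D <= (c0 R)^-1 * (Lam * ln y * L + 300 * y `^ (- c)).
  rewrite ler_pdivlMl ?c0_gt0//; apply: (le_trans hD).
  by rewrite lerD2l; apply: ler_wpM2l cc; exact: ltW.
move=> /le_trans; apply.
rewrite mulrDr; apply: lerD.
- rewrite (_ : _ * (Lam * _ * _) = (c0 R)^-1 * Lam * (L * ln y)); last by ring.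
  by rewrite ler_wpM2r.
- by rewrite mulrA ler_wpM2r.
Qed.
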